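(* Let $\mathcal{A}$ be a unital operator algebra and let $\pi$ be an irreducible $*$-representation of $\mathrm{C}^*_e(\mathcal{A})$. Then, $\pi$ is a strongly peaking representation for $\mathcal{A}$ if and only if it is a strongly peaking representation for $\mathrm{C}^*_e(\mathcal{A})$.
   Context: A unital operator algebra is a subalgebra of some $B(\mathcal{H})$ containing the identity. $\mathrm{C}^*$-envelope: $\mathrm{C}^*_e(\mathcal{A})$ is the unital $\mathrm{C}^*$-algebra $\mathfrak{E}$, with a unital completely isometric map $u:\mathcal{A}\to\mathfrak{E}$ such that $\mathfrak{E}=\mathrm{C}^*(u(\mathcal{A}))$, having the universal property that for every unital $\mathrm{C}^*$-algebra $\mathfrak{A}$ and unital completely isometric linear map $\iota:\mathcal{A}\to\mathfrak{A}$ with $\mathfrak{A}=\mathrm{C}^*(\iota(\mathcal{A}))$ there is a surjective $*$-homomorphism $q:\mathfrak{A}\to\mathfrak{E}$ with $q\circ\iota=u$. The map $u$ is then a homomorphism, and $\mathcal{A}$ is identified with $u(\mathcal{A})\subset \mathrm{C}^*_e(\mathcal{A})$. Strongly peaking: let $\mathfrak{A}$ be a $\mathrm{C}^*$-algebra, $\mathcal{S}\subset\mathfrak{A}$ a subset, $\pi$ an irreducible $*$-representation of $\mathfrak{A}$. Then $\pi$ is a strongly peaking representation for $\mathcal{S}$ if there are $n\in\mathbb{N}$ and $T\in\mathbb{M}_n(\mathcal{S})$ with $\|\pi^{(n)}(T)\|>\sup_\sigma\|\sigma^{(n)}(T)\|$, the supremum being over all irreducible $*$-representations $\sigma$ of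 $\mathfrak{A}$ not unitarily equivalent to $\pi$; here $\sigma^{(n)}$ is the entrywise ampliation of $\sigma$ to $\mathbb{M}_n(\mathfrak{A})$. In the claim, $\mathfrak{A}=\mathrm{C}^*_e(\mathcal{A})$ in both cases. *)

(* Defs.v *)
From HB Require Import structures.
From mathcomp Require Import all_boot all_order all_algebra.
From mathcomp Require Import all_classical all_reals.
From mathcomp Require Import ereal topology normedtype.
From mathcomp Require Import complex.

Set Implicit Arguments.
Unset Strict Implicit.
Unset Printing Implicit Defensive.

Import Order.TTheory GRing.Theory Num.Theory.
Import numFieldNormedType.Exports.

Local Open Scope classical_set_scope.
Local Open Scope ring_scope.

(* The scalar field is R[i], the complex numbers over the reals R. In the form
   hdot the first argument is the linear one. *)
HB.mixin Record CompleteNormedModule_isHilbert (R : realType) (H : Type)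
    of CompleteNormedModule R[i] H := {
  hdot : {dot H for @Num.conj R[i]} ;
  hdotE : forall x : H, hdot x x = `|x| ^+ 2
}.
#[short(type="hilbertType")]
HB.structure Definition Hilbert (R : realType) :=
  {H of CompleteNormedModule R[i] H & CompleteNormedModule_isHilbert R H}.

(* Unital C*-algebras. The product and the unit are fields of the structure
   because a ring structure and a norm on the same type can only be joined, in
   the MathComp hierarchy, above numDomainType. The zero algebra is allowed. *)
HB.mixin Record CompleteNormedModule_isCStar (R : realType) (A : Type)
    of CompleteNormedModule R[i] A := {
  cmul : A -> A -> A ;
  cone : A ;
  star : A -> A ;
  cmulA : associative cmul ;
  cmul1a : left_id cone cmul ;
  cmula1 : right_id cone cmul ;
  cmul_linearl : forall b : A, linear (cmul ^~ b) ;
  cmul_linearr : forall a : A, linear (cmul a) ;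
  starD : {morph star : a b / a + b} ;
  starZ : forall (k : R[i]) (a : A), star (k *: a) = k^* *: star a ;
  starM : forall a b : A, star (cmul a b) = cmul (star b) (star a) ;
  starK : involutive star ;
  cmul_norm : forall a b : A, `|cmul a b| <= `|a| * `|b| ;
  cstar_norm : forall a : A, `|cmul (star a) a| = `|a| ^+ 2
}.
#[short(type="cstarType")]
HB.structure Definition CStar (R : realType) :=
  {A of CompleteNormedModule R[i] A & CompleteNormedModule_isCStar R A}.

(* The norm of a normed space over R[i] takes its (real) values in R[i]. *)
Definition rnorm (R : realType) (V : normedModType R[i]) (x : V) : R :=
  complex.Re `|x|.

Section Operators.
Context {R : realType}.

Definition bounded_op (H : hilbertType R) (f : H -> H) : Prop :=
  linear f /\ exists M : R[i], forall x : H, `|f x| <= M * `|x|.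

(* Operator norm of a matrix of operators acting on the Hilbert sum H^n. *)
Definition op_mxnorm (H : hilbertType R) (n : nat) (T : 'M[H -> H]_n) : \bar R :=
  ereal_sup
    [set (Num.sqrt (\sum_i rnorm (\sum_j T i j (x j)) ^+ 2))%:E
      | x in [set x : 'I_n -> H | \sum_j rnorm (x j) ^+ 2 <= 1]].

Definition unital_operator_algebra (H : hilbertType R) (A : set (H -> H)) : Prop :=
  [/\ A `<=` @bounded_op H,
      A idfun,
      forall (k : R[i]) f g, A f -> A g -> A (k *: f + g) &
      forall f g, A f -> A g -> A (f \o g)].

End Operators.

Section Representations.
Context {R : realType}.

Definition star_hom (A B : cstarType R) (q : A -> B) : Prop :=
  [/\ linear q,
      {morph q : a b / cmul a b} &
      {morph q : a / star a}].

Definition star_rep (A : cstarType R) (H : hilbertType R)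
    (s : A -> H -> H) : Prop :=
  [/\ forall a, bounded_op (s a),
      linear s,
      forall a b, s (cmul a b) = s a \o s b &
      forall a x y, hdot (s a x) y = hdot x (s (star a) y)].

Definition irreducible_rep (A : cstarType R) (H : hilbertType R)
    (s : A -> H -> H) : Prop :=
  [/\ star_rep s,
      exists a x, s a x != 0 &
      forall V : set H,
        closed V -> V 0 ->
        (forall (k : R[i]) x y, V x -> V y -> V (k *: x + y)) ->
        (forall a x, V x -> V (s a x)) ->
        V = [set 0] \/ V = setT].

Definition unitarily_equivalent (A : cstarType R) (H K : hilbertType R)
    (s : A -> H -> H) (t : A -> K -> K) : Prop :=
  exists U : H -> K,
    [/\ linear U,
        range U = setT,
        forall x y, hdot (U x) (U y) = hdot x y &
        forall a x, U (s a x) = t a (U x)].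

(* For a C*-algebra with a single class of irreducible representations the
   supremum is over the empty set, hence -oo, and any T is a witness; with the
   value 0 instead, the unit of A would be one. *)
Definition strongly_peaking (A : cstarType R) (S : set A)
    (H : hilbertType R) (pi : A -> H -> H) : Prop :=
  exists (n : nat) (T : 'M[A]_n),
    [/\ (0 < n)%N,
        forall i j, S (T i j) &
        (ereal_sup [set r | exists (K : hilbertType R) (s : A -> K -> K),
            [/\ irreducible_rep s, ~ unitarily_equivalent s pi &
                r = op_mxnorm (map_mx s T)]]
         < op_mxnorm (map_mx pi T))%E].

(* The C*-norm of M_n(A), obtained by letting A act on Hilbert spaces: it is
   the largest of the norms induced by the *-representations of A, and is
   attained by every faithful one. *)
Definition cstar_mxnorm (A : cstarType R) (n : nat) (T : 'M[A]_n) : \bar R :=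
  ereal_sup [set r | exists (H : hilbertType R) (s : A -> H -> H),
    star_rep s /\ r = op_mxnorm (map_mx s T)].

Definition cstar_subalgebra (A : cstarType R) (B : set A) : Prop :=
  [/\ closed B,
      B 0,
      forall (k : R[i]) a b, B a -> B b -> B (k *: a + b),
      forall a b, B a -> B b -> B (cmul a b) &
      forall a, B a -> B (star a)].

Definition cstar_generated (A : cstarType R) (S : set A) : set A :=
  smallest (@cstar_subalgebra A) S.

End Representations.

Section Envelope.
Context {R : realType}.

(* A map on the operator algebra A is a function on all of H -> H of which only
   the values on A matter. *)
Definition unital_ci_map (H : hilbertType R) (A : set (H -> H))
    (B : cstarType R) (u : (H -> H) -> B) : Prop :=
  [/\ forall (k : R[i]) f g, A f -> A g -> u (k *: f + g) = k *: u f + u g,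
      u idfun = cone &
      forall (n : nat) (T : 'M[H -> H]_n), (forall i j, A (T i j)) ->
        cstar_mxnorm (map_mx u T) = op_mxnorm T].

Definition cstar_envelope (H : hilbertType R) (A : set (H -> H))
    (E : cstarType R) (u : (H -> H) -> E) : Prop :=
  [/\ unital_ci_map A u,
      cstar_generated (u @` A) = setT &
      forall (B : cstarType R) (iota : (H -> H) -> B),
        unital_ci_map A iota -> cstar_generated (iota @` A) = setT ->
        exists q : B -> E,
          [/\ star_hom q, range q = setT & forall f, A f -> q (iota f) = u f]].

End Envelope.

(* Main.v *)
Require Import Defs.
From HB Require Import structures.
From mathcomp Require Import all_boot all_order all_algebra.
From mathcomp Require Import all_classical all_reals.
From mathcomp Require Import ereal topology normedtype sequences derive.
From mathcomp Require Import generic_quotient complex.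
From mathcomp Require Import ring lra.

Set Implicit Arguments.
Unset Strict Implicit.
Unset Printing Implicit Defensive.

Import Order.TTheory GRing.Theory Num.Theory.
Import numFieldNormedType.Exports.

Local Open Scope classical_set_scope.
Local Open Scope ring_scope.

(** A matrix over A witnesses peaking over the larger set E as well, so the point
    is to descend from E = C*_e(A) to A. Let S be the class of the irreducible
    representations of E that are not equivalent to pi, and let p(a) be the
    supremum of the norms of s(a), for s in S. This is a C*-seminorm on E. Let B
    be the C*-algebra completing E for p, and iota : E -> B the canonical map; the
    members of S extend to B ([rep_extension]).

    Suppose first that iota preserves the matrix norms of A. The universal
    property of the envelope gives a *-homomorphism q : B -> E that inverts iota
    on A; then pi o q o iota and pi are representations of E that agree on the
    generating set A, so pi = (pi o q) o iota ([star_rep_unique]). The norm of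
    pi(T) is thus at most the norm of iota(T), which for every matrix T over E is
    at most the supremum over S of the norms of s(T) ([complete_contraction]).
    So pi does not peak on E.

    Hence if pi peaks on E, then some matrix T over A has a norm in B strictly
    less than its norm in E. The latter is the supremum of the norms of t(T) over
    irreducible t ([irreducible_norming]); so some irreducible t has a norm at T
    above that of iota(T). A member of S, being a representation of B, has norm
    at T at most that of iota(T). So t is not in S, that is, t is equivalent to
    pi, and pi peaks at T.

    Two facts carry the argument. The first is that a self-adjoint h of norm less
    than 1 has the form 2 d - d^2 with d self-adjoint, so that 1 - h is a square
    ([quasi_sqrt], [matrix_quasi_sqrt]); this makes representations contractive,
    also on matrices, without spectral theory. The second is that irreducible
    representations compute matrix norms: states are replaced by positive forms
    on the columns E^n, extreme ones exist by the argument of Krein and Milman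
    ([extreme_max]), and the representation obtained from an extreme one by the
    GNS construction ([gns]) is irreducible ([extreme_irreducible]). *)

(** * Linear maps, real norms and norm convergence *)

(** Most maps below are shown to be linear without carrying a structure, hence
    these consequences of the bare property. *)
Section LinearMaps.
Context {K : pzRingType} {U W : lmodType K} {f : U -> W}.
Hypothesis flin : linear f.

Lemma lin0 : f 0 = 0.
Proof. by have := flin (-1) 0 0; rewrite scaler0 addr0 scaleN1r addNr. Qed.

Lemma linD : {morph f : x y / x + y}.
Proof. by move=> x y; have := flin 1 x y; rewrite !scale1r. Qed.

Lemma linZ k x : f (k *: x) = k *: f x.
Proof. by have := flin k x 0; rewrite lin0 !addr0. Qed.

Lemma linB : {morph f : x y / x - y}.
Proof. by move=> x y; have := flin (-1) y x; rewrite !scaleN1r ![- _ + _]addrC. Qed.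

Lemma lin_sum (I : finType) (F : I -> U) : f (\sum_i F i) = \sum_i f (F i).
Proof. exact: (big_morph f linD lin0). Qed.
End LinearMaps.

Section RealNorm.
Context {R : realType}.
Implicit Types (V W : normedModType R[i]) (k : R[i]).

Definition rabs (k : R[i]) : R := complex.Re `|k|.

Lemma rabsE k : `|k| = (rabs k)%:C%C.
Proof. by rewrite /rabs normc_def. Qed.

Lemma rabs_ge0 k : 0 <= rabs k.
Proof. by have := normr_ge0 k; rewrite rabsE ler0c. Qed.

Lemma rabsM k l : rabs (k * l) = rabs k * rabs l.
Proof. by apply: complexI; rewrite rmorphM -!rabsE normrM. Qed.

Lemma rabsR (t : R) : rabs t%:C%C = `|t|.
Proof. by rewrite /rabs normc_def /= expr0n addr0 sqrtr_sqr. Qed.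

Lemma rabs_sqr k : rabs k ^+ 2 = complex.Re k ^+ 2 + complex.Im k ^+ 2.
Proof. by rewrite /rabs normc_def /= sqr_sqrtr // addr_ge0 ?sqr_ge0. Qed.

Lemma rabsN1 : rabs (- 1) = 1.
Proof. by rewrite /rabs normrN1. Qed.

Lemma rnormE V (x : V) : `|x| = (rnorm x)%:C%C.
Proof. by rewrite /rnorm RRe_real // normr_real. Qed.

Lemma rnorm_ge0 V (x : V) : 0 <= rnorm x.
Proof. by have := normr_ge0 x; rewrite rnormE ler0c. Qed.

Lemma rnormD V (x y : V) : rnorm (x + y) <= rnorm x + rnorm y.
Proof. by rewrite -lecR rmorphD /= -!rnormE ler_normD. Qed.

Lemma rnormZ V k (x : V) : rnorm (k *: x) = rabs k * rnorm x.
Proof. by apply: complexI; rewrite rmorphM /= -!rnormE -rabsE normrZ. Qed.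

Lemma rnorm0_eq0 V (x : V) : rnorm x = 0 -> x = 0.
Proof. by move=> x0; apply/normr0_eq0; rewrite rnormE x0. Qed.

Lemma rnorm0 V : rnorm (0 : V) = 0.
Proof. by rewrite /rnorm normr0. Qed.

Lemma rnormN V (x : V) : rnorm (- x) = rnorm x.
Proof. by rewrite /rnorm normrN. Qed.

Lemma rnormB V (x y : V) : rnorm (x - y) = rnorm (y - x).
Proof. by rewrite -rnormN opprB. Qed.

(** The norms take their values in R[i], which is only partially ordered; limits
    are therefore computed with the real-valued [rnorm]. *)
Definition tends V (u : nat -> V) (x : V) :=
  (fun n => rnorm (u n - x)) @ \oo --> (0 : R).

Lemma null_le (f g : nat -> R) : (forall n, 0 <= f n <= g n) ->
  g @ \oo --> (0 : R) -> f @ \oo --> (0 : R).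
Proof.
move=> fg g0; have fg' : \forall n \near \oo, 0 <= f n <= g n by apply: nearW.
by apply: (squeeze_cvgr fg') => //; exact: cvg_cst.
Qed.

Lemma null_add (f g : nat -> R) :
  f @ \oo --> (0 : R) -> g @ \oo --> (0 : R) ->
  (fun n => f n + g n) @ \oo --> (0 : R).
Proof. by move=> f0 g0; have := cvgD f0 g0; rewrite addr0; apply. Qed.

Lemma null_scale (c : R) (f : nat -> R) :
  f @ \oo --> (0 : R) -> (fun n => c * f n) @ \oo --> (0 : R).
Proof. by move=> f0; have := cvgM (cvg_cst c) f0; rewrite mulr0; apply. Qed.

Lemma tends_cst V (x : V) : tends (fun=> x) x.
Proof.
rewrite /tends; under eq_fun do rewrite subrr rnorm0.
exact: cvg_cst.
Qed.

Lemma tends_eq V (u v : nat -> V) x : u =1 v -> tends u x -> tends v x.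
Proof. by move=> /funext ->. Qed.

Lemma tendsD V (u v : nat -> V) x y :
  tends u x -> tends v y -> tends (fun n => u n + v n) (x + y).
Proof.
move=> ux vy; apply: null_le (fun n => rnorm (u n - x) + rnorm (v n - y)) _ _.
  by move=> n; rewrite rnorm_ge0 opprD addrACA rnormD.
exact: null_add.
Qed.

Lemma tendsZ V k (u : nat -> V) x :
  tends u x -> tends (fun n => k *: u n) (k *: x).
Proof.
move=> ux; rewrite /tends.
under eq_fun do rewrite -scalerBr rnormZ.
exact: null_scale.
Qed.

Lemma tends_norm V (u : nat -> V) x :
  tends u x -> (fun n => rnorm (u n)) @ \oo --> rnorm x.
Proof.
move=> ux; apply/subr_cvg0.
apply/norm_cvg0P; apply: null_le ux => n /=; rewrite normr_ge0 /=.
have := rnormD (u n - x) x; have := rnormD (x - u n) (u n).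
rewrite !subrK (rnormB x) ler_norml => ? ?; lra.
Qed.

Lemma tends_unique V (u : nat -> V) x y : tends u x -> tends u y -> x = y.
Proof.
move=> ux uy; apply/eqP; rewrite -subr_eq0; apply/eqP/rnorm0_eq0.
have /cvg_lim <- // : (fun n : nat => rnorm (x - y)) @ \oo --> (0 : R).
  apply: null_le (fun n => rnorm (u n - x) + rnorm (u n - y)) _ _.
    move=> n; rewrite rnorm_ge0 (rnormB (u n) x) /=.
    by apply: le_trans (rnormD _ _); rewrite addrA subrK.
  exact: null_add.
by rewrite lim_cst.
Qed.
End RealNorm.

(** * Sequences *)

Section Sequences.
Context {R : realType}.
Implicit Types (V : normedModType R[i]).

Lemma posC (e : R[i]) : 0 < e -> exists2 r : R, 0 < r & e = r%:C%C.
Proof.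
case: e => a b; rewrite ltcE /= => /andP[/eqP -> a0]; by exists a.
Qed.

Lemma nullP (f : nat -> R) : (forall n, 0 <= f n) ->
  (f @ \oo --> (0 : R)) <->
  (forall e, 0 < e -> exists N, forall n, (N <= n)%N -> f n < e).
Proof.
move=> f0; split.
  move=> /cvgrPdist_lt h e /h [N _ hN]; exists N => n /hN /=.
  by rewrite sub0r normrN ger0_norm.
move=> h; apply/cvgrPdist_lt => e /h [N hN]; exists N => // n /hN /=.
by rewrite sub0r normrN ger0_norm.
Qed.

Lemma tendsP V (u : nat -> V) x : tends u x <->
  (forall e, 0 < e -> exists N, forall n, (N <= n)%N -> rnorm (u n - x) < e).
Proof. by apply: nullP => n; exact: rnorm_ge0. Qed.

Lemma tends_cvg V (u : nat -> V) (x : V) : tends u x -> u @ \oo --> x.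
Proof.
move=> /tendsP ux; apply/cvgrPdist_lt => _ /posC[r r0 ->].
have [N hN] := ux r r0; exists N => // n /hN.
by rewrite /= rnormE ltcR rnormB.
Qed.

Lemma closed_tends V (B : set V) u x :
  closed B -> (forall n, B (u n)) -> tends u x -> B x.
Proof.
move=> cB Bu /tends_cvg ux; have nB : \forall n \near \oo, B (u n) by exact: nearW.
exact: (@closed_cvg _ _ \oo _ u B cB nB x ux).
Qed.

Lemma closed_seq V (B : set V) :
  (forall u x, (forall n, B (u n)) -> tends u x -> B x) -> closed B.
Proof.
move=> h x clx.
have ex n : exists y, B y /\ rnorm (y - x) < n.+1%:R^-1.
  have [y [By yx]] := clx _ (nbhsx_ballx x ((n.+1%:R^-1)%:C%C : R[i])
    ltac:(by rewrite ltcR invr_gt0 ltr0n)).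
  exists y; split => //; move: yx.
  by rewrite -ball_normE /ball_ /= rnormE ltcR rnormB.
pose u n := sval (cid (ex n)).
apply: (h u) => [n|]; first by rewrite /u; have [] := svalP (cid (ex n)).
apply: (@null_le _ _ (fun n => n.+1%:R^-1)); last exact: (@cvg_harmonic R).
by move=> n; rewrite rnorm_ge0 /u; have [_ /ltW] := svalP (cid (ex n)).
Qed.

Lemma tends_shift V (u : nat -> V) x : tends u x -> tends (fun n => u n.+1) x.
Proof.
move=> /tendsP ux; apply/tendsP => e /ux[N hN].
by exists N => n Nn; apply: hN; rewrite leqW.
Qed.

Definition rcauchy V (u : nat -> V) := forall e : R, 0 < e ->
  exists N, forall m n, (N <= m)%N -> (N <= n)%N -> rnorm (u m - u n) < e.

Lemma rcauchy_tends (V : completeNormedModType R[i]) (u : nat -> V) :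
  rcauchy u -> exists x, tends u x.
Proof.
move=> cu.
have /cvg_ex[x ux] : cvg (u @ \oo).
  apply: cauchy_cvg; apply/cauchy_ballP => _ /posC[r r0 ->].
  have [N hN] := cu r r0.
  exists (u @` [set n | (N <= n)%N], u @` [set n | (N <= n)%N]) => /=.
    by split; exists N => // n Nn; exists n.
  move=> [_ _] /= [[m Nm <-] [n Nn <-]].
  by rewrite -ball_normE /ball_ /= rnormE ltcR hN.
exists x; apply/tendsP => e e0.
move/cvgrPdist_lt : ux => /(_ e%:C%C) [|N _ hN]; first by rewrite ltcR.
by exists N => n /hN /=; rewrite rnormE ltcR rnormB.
Qed.

Lemma real_cauchy (f : nat -> R) :
  (forall e : R, 0 < e ->
    exists N, forall m n, (N <= m)%N -> (N <= n)%N -> `|f m - f n| < e) ->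
  cvgn f.
Proof.
move=> cu; apply: cauchy_cvg; apply/cauchy_ballP => r r0.
have [N hN] := cu r r0.
exists (f @` [set n | (N <= n)%N], f @` [set n | (N <= n)%N]) => /=.
  by split; exists N => // n Nn; exists n.
by move=> [_ _] /= [[m Nm <-] [n Nn <-]]; rewrite /ball /= hN.
Qed.

Lemma le_mul_lim (x y c : R) : 0 <= y -> (forall t, c < t -> x <= t * y) ->
  x <= c * y.
Proof.
move=> y0 h; apply/ler_addgt0Pr => e e0; have y1 : 0 < y + 1 by lra.
have := h (c + e / (y + 1)) ltac:(by rewrite ltrDl divr_gt0).
move/le_trans; apply; rewrite mulrDl lerD2l -mulrA ger_pMr // mulrC.
by rewrite ler_pdivrMr // mul1r; lra.
Qed.

Lemma rlim_uniq (f : nat -> R) (a b : R) :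
  f @ \oo --> a -> f @ \oo --> b -> a = b.
Proof. by move=> fa fb; rewrite -(cvg_lim _ fa) // (cvg_lim _ fb). Qed.

Lemma rlim_le (f g : nat -> R) (a b : R) : f @ \oo --> a -> g @ \oo --> b ->
  (forall n, f n <= g n) -> a <= b.
Proof. by move=> fa gb fg; apply: ler_cvg_to fa gb _; exact: nearW. Qed.

Lemma rlimM (f g : nat -> R) (a b : R) : f @ \oo --> a -> g @ \oo --> b ->
  (fun n => f n * g n) @ \oo --> a * b.
Proof. by move=> fa gb; apply: cvgM. Qed.

Lemma rlimD (f g : nat -> R) (a b : R) : f @ \oo --> a -> g @ \oo --> b ->
  (fun n => f n + g n) @ \oo --> a + b.
Proof. by move=> fa gb; apply: cvgD. Qed.

Lemma rlimB (f g : nat -> R) (a b : R) : f @ \oo --> a -> g @ \oo --> b ->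
  (fun n => f n - g n) @ \oo --> a - b.
Proof. by move=> fa gb; apply: cvgB. Qed.

Lemma rlimZ (c : R) (f : nat -> R) (a : R) : f @ \oo --> a ->
  (fun n => c * f n) @ \oo --> c * a.
Proof. by move=> fa; apply: rlimM fa; apply: cvg_cst. Qed.

Lemma rlim_eq (f g : nat -> R) (a : R) : f =1 g -> f @ \oo --> a -> g @ \oo --> a.
Proof. by move=> /funext ->. Qed.
End Sequences.

(** * Completion of a seminormed space *)

Record seminorm (R : realType) (V : lmodType R[i]) := Seminorm {
  sn :> V -> R ;
  snD : forall x y, sn (x + y) <= sn x + sn y ;
  snZ : forall (k : R[i]) x, sn (k *: x) = rabs k * sn x }.

Section Completion.
Context {R : realType} {V : lmodType R[i]} (p : seminorm V).

Lemma sn0 : p 0 = 0.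
Proof. by rewrite -(scale0r 0) snZ /rabs normr0 mul0r. Qed.

Lemma snN x : p (- x) = p x.
Proof. by rewrite -scaleN1r snZ rabsN1 mul1r. Qed.

Lemma snB x y : p (x - y) = p (y - x).
Proof. by rewrite -snN opprB. Qed.

Lemma sn_ge0 x : 0 <= p x.
Proof. by have := snD p x (- x); rewrite subrr sn0 snN => ?; lra. Qed.

Lemma sn_dist x y : `|p x - p y| <= p (x - y).
Proof.
have := snD p (x - y) y; have := snD p (y - x) x.
rewrite !subrK (snB y) ler_norml => ? ?; lra.
Qed.

Lemma sn_sum (I : finType) (F : I -> V) : p (\sum_i F i) <= \sum_i p (F i).
Proof.
apply: (big_ind2 (fun x y => p x <= y)) => //; first by rewrite sn0.
by move=> x y x' y' h h'; apply: le_trans (snD _ _ _) (lerD h h').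
Qed.

Definition cauchy_in (u : nat -> V) := forall e : R, 0 < e ->
  exists N, forall m n, (N <= m)%N -> (N <= n)%N -> p (u m - u n) < e.

Record cseq := CSeq { cs :> nat -> V ; csP : cauchy_in cs }.

HB.instance Definition _ := gen_eqMixin cseq.
HB.instance Definition _ := gen_choiceMixin cseq.

Definition near_seq (u v : nat -> V) :=
  (fun n => p (u n - v n)) @ \oo --> (0 : R).

Lemma near_refl u : near_seq u u.
Proof.
rewrite /near_seq; under eq_fun do rewrite subrr sn0.
exact: cvg_cst.
Qed.

Lemma near_sym u v : near_seq u v -> near_seq v u.
Proof. by rewrite /near_seq; under eq_fun do rewrite snB. Qed.

Lemma near_trans v u w : near_seq u v -> near_seq v w -> near_seq u w.
Proof.
move=> uv vw; apply: null_le (null_add uv vw) => n; rewrite sn_ge0 /=.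
by apply: le_trans (snD _ _ _); rewrite addrA subrK.
Qed.

Lemma near_add u v u' v' : near_seq u u' -> near_seq v v' ->
  near_seq (fun n => u n + v n) (fun n => u' n + v' n).
Proof.
move=> uu vv; apply: null_le (null_add uu vv) => n; rewrite sn_ge0 /=.
by rewrite opprD addrACA snD.
Qed.

Lemma near_scale k u v : near_seq u v ->
  near_seq (fun n => k *: u n) (fun n => k *: v n).
Proof.
move=> uv; rewrite /near_seq; under eq_fun do rewrite -scalerBr snZ.
exact: null_scale.
Qed.

Lemma cauchy_add u v : cauchy_in u -> cauchy_in v ->
  cauchy_in (fun n => u n + v n).
Proof.
move=> cu cv e e0; have e20 : 0 < e / 2 by lra.
have [N hN] := cu _ e20; have [M hM] := cv _ e20.
exists (maxn N M) => m n; rewrite !geq_max => /andP[Nm Mm] /andP[Nn Mn].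
rewrite opprD addrACA; apply: le_lt_trans (snD _ _ _) _.
by have := hN _ _ Nm Nn; have := hM _ _ Mm Mn => ? ?; lra.
Qed.

Lemma cauchy_scale k u : cauchy_in u -> cauchy_in (fun n => k *: u n).
Proof.
move=> cu e e0; have k1 : 0 < rabs k + 1 by have := rabs_ge0 k; lra.
have [N hN] := cu _ (divr_gt0 e0 k1).
exists N => m n Nm Nn; rewrite -scalerBr snZ.
have := hN _ _ Nm Nn; rewrite ltr_pdivlMr // => h; apply: le_lt_trans h.
have := sn_ge0 (u m - u n); nra.
Qed.

Lemma cauchy_cst x : cauchy_in (fun=> x).
Proof. by move=> e e0; exists 0%N => m n _ _; rewrite subrr sn0. Qed.

Lemma cauchy_cvg_sn u : cauchy_in u -> cvgn (p \o u).
Proof.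
move=> cu; apply: real_cauchy => e /cu[N hN]; exists N => m n Nm Nn.
exact: le_lt_trans (sn_dist _ _) (hN _ _ Nm Nn).
Qed.

Definition cseq_eq (u v : cseq) : bool := `[< near_seq u v >].

Lemma cseq_eq_refl : reflexive cseq_eq.
Proof. by move=> u; apply/asboolP; exact: near_refl. Qed.
Lemma cseq_eq_sym : symmetric cseq_eq.
Proof. by move=> u v; apply/asboolP/asboolP; exact: near_sym. Qed.
Lemma cseq_eq_trans : transitive cseq_eq.
Proof.
by move=> v u w /asboolP uv /asboolP vw; apply/asboolP; exact: near_trans vw.
Qed.

Canonical cseq_equiv :=
  EquivRel cseq_eq cseq_eq_refl cseq_eq_sym cseq_eq_trans.

(** The vectors of seminorm 0 become 0 here, so that the seminorm extends to a
    norm. *)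
Definition completion := {eq_quot cseq_equiv}%qT.
HB.instance Definition _ := Choice.on completion.
HB.instance Definition _ := EqQuotient.on completion.

Local Open Scope quotient_scope.

(** Identities in the completion are proved on representing sequences, see
    [rep_eq]. *)
Definition rep (u : nat -> V) (x : completion) :=
  near_seq u (cs (repr x)).

Definition cls (u : cseq) : completion := \pi_completion u.

Lemma rep_cls (u : cseq) : rep u (cls u).
Proof.
have /eqmodP/asboolP h : repr (cls u) = u %[mod completion] by rewrite reprK.
exact: near_sym.
Qed.

Lemma rep_uniq u x y : rep u x -> rep u y -> x = y.
Proof.
move=> ux uy; rewrite -(reprK x) -(reprK y); apply/eqmodP/asboolP.
by apply: near_trans uy; apply: near_sym.
Qed.

Lemma rep_repr (x : completion) : rep (repr x) x. Proof. exact: near_refl. Qed.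

Definition cadd (x y : completion) : completion :=
  cls (CSeq (cauchy_add (csP (repr x)) (csP (repr y)))).
Definition cscale k (x : completion) : completion :=
  cls (CSeq (cauchy_scale k (csP (repr x)))).
Definition emb v : completion := cls (CSeq (cauchy_cst v)).

Lemma rep_emb v : rep (fun=> v) (emb v).
Proof. exact: (rep_cls (CSeq (cauchy_cst v))). Qed.

Lemma rep_add u v x y : rep u x -> rep v y ->
  rep (fun n => u n + v n) (cadd x y).
Proof.
move=> ux vy; apply: near_trans (near_add ux vy) _.
exact: (rep_cls (CSeq _)).
Qed.

Lemma rep_scale k u x : rep u x -> rep (fun n => k *: u n) (cscale k x).
Proof.
move=> ux; apply: near_trans (near_scale k ux) _.
exact: (rep_cls (CSeq _)).
Qed.

Lemma rep_eq u v x y : rep u x -> rep v y -> u =1 v -> x = y.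
Proof. by move=> ux vy /funext uv; apply: rep_uniq vy; rewrite -uv. Qed.

Lemma completion_addA : associative cadd.
Proof.
move=> x y z.
apply: rep_eq (rep_add (rep_repr x) (rep_add (rep_repr y) (rep_repr z)))
  (rep_add (rep_add (rep_repr x) (rep_repr y)) (rep_repr z)) _ => n.
exact: addrA.
Qed.

Lemma completion_addC : commutative cadd.
Proof.
move=> x y; apply: rep_eq (rep_add (rep_repr x) (rep_repr y))
  (rep_add (rep_repr y) (rep_repr x)) _ => n; exact: addrC.
Qed.

Lemma completion_add0 : left_id (emb 0) cadd.
Proof.
move=> x; apply: rep_eq (rep_add (rep_emb 0) (rep_repr x)) (rep_repr x) _ => n.
exact: add0r.
Qed.

Lemma completion_addN : left_inverse (emb 0) (cscale (-1)) cadd.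
Proof.
move=> x; apply: rep_eq (rep_add (rep_scale _ (rep_repr x)) (rep_repr x))
  (rep_emb 0) _ => n.
by rewrite scaleN1r addNr.
Qed.

HB.instance Definition _ := GRing.isZmodule.Build completion
  completion_addA completion_addC completion_add0 completion_addN.

Lemma completion_scaleA k l x : cscale k (cscale l x) = cscale (k * l) x.
Proof.
apply: rep_eq (rep_scale _ (rep_scale _ (rep_repr x)))
  (rep_scale _ (rep_repr x)) _ => n; exact: scalerA.
Qed.

Lemma completion_scale1 : left_id 1 cscale.
Proof.
move=> x; apply: rep_eq (rep_scale _ (rep_repr x)) (rep_repr x) _ => n.
exact: scale1r.
Qed.

Lemma completion_scaleDr : right_distributive cscale +%R.
Proof.
move=> k x y.
apply: rep_eq (rep_scale _ (rep_add (rep_repr x) (rep_repr y)))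
  (rep_add (rep_scale _ (rep_repr x)) (rep_scale _ (rep_repr y))) _ => n.
exact: scalerDr.
Qed.

Lemma completion_scaleDl x : {morph cscale^~ x : k l / k + l}.
Proof.
move=> k l.
apply: rep_eq (rep_scale _ (rep_repr x))
  (rep_add (rep_scale _ (rep_repr x)) (rep_scale _ (rep_repr x))) _ => n.
exact: scalerDl.
Qed.

HB.instance Definition _ := GRing.Zmodule_isLmodule.Build R[i] completion
  completion_scaleA completion_scale1 completion_scaleDr completion_scaleDl.

Definition cnorm (x : completion) : R := limn (p \o cs (repr x)).

Lemma rep_cnorm u x : rep u x -> (fun n => p (u n)) @ \oo --> cnorm x.
Proof.
move=> ux; have cx : (p \o cs (repr x)) @ \oo --> cnorm x.
  exact: cauchy_cvg_sn (csP _).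
have d0 : (fun n => p (u n) - p (cs (repr x) n)) @ \oo --> (0 : R).
  apply/norm_cvg0P; apply: null_le ux => n /=.
  by rewrite normr_ge0 sn_dist.
have -> : (fun n => p (u n)) =
    (fun n => (p (u n) - p (cs (repr x) n)) + p (cs (repr x) n)).
  by apply/funext => n; rewrite subrK.
by have := cvgD d0 cx; rewrite add0r; apply.
Qed.

Lemma cnorm_emb v : cnorm (emb v) = p v.
Proof.
have h : (fun n : nat => p v) @ \oo --> cnorm (emb v) := rep_cnorm (rep_emb v).
by rewrite -(cvg_lim _ h) // lim_cst.
Qed.

Lemma cnorm_triangle x y : cnorm (x + y) <= cnorm x + cnorm y.
Proof.
have h := rep_cnorm (rep_add (rep_repr x) (rep_repr y)).
have hx := rep_cnorm (rep_repr x); have hy := rep_cnorm (rep_repr y).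
by apply: rlim_le h (cvgD hx hy) _ => n; exact: snD.
Qed.

Lemma cnorm_scale k x : cnorm (k *: x) = rabs k * cnorm x.
Proof.
have h := rep_cnorm (rep_scale k (rep_repr x)).
have hx := rep_cnorm (rep_repr x).
have h2 := cvgM (cvg_cst (rabs k)) hx.
by apply: rlim_uniq h _; under eq_fun do rewrite snZ; exact: h2.
Qed.

Lemma cnorm0_eq0 x : cnorm x = 0 -> x = 0.
Proof.
move=> x0; apply: rep_uniq (rep_repr x) _; rewrite /rep.
apply: near_trans (rep_emb 0); rewrite /near_seq.
under eq_fun do rewrite subr0.
by rewrite -x0; exact: rep_cnorm (rep_repr x).
Qed.

Definition cnormC (x : completion) : R[i] := (cnorm x)%:C%C.

Lemma cnormC_triangle x y : cnormC (x + y) <= cnormC x + cnormC y.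
Proof. by rewrite /cnormC -rmorphD lecR cnorm_triangle. Qed.
Lemma cnormC_scale k x : cnormC (k *: x) = `|k| * cnormC x.
Proof. by rewrite /cnormC cnorm_scale rmorphM rabsE. Qed.
Lemma cnormC0_eq0 x : cnormC x = 0 -> x = 0.
Proof. by move=> [/cnorm0_eq0]. Qed.

HB.instance Definition _ := Lmodule_isNormed.Build R[i] completion
  cnormC_triangle cnormC_scale cnormC0_eq0.

Lemma rnorm_completion (x : completion) : rnorm x = cnorm x.
Proof. by []. Qed.

Lemma rnorm_emb v : rnorm (emb v) = p v.
Proof. by rewrite rnorm_completion cnorm_emb. Qed.

Lemma embP k v w : emb (k *: v + w) = k *: emb v + emb w.
Proof.
by apply: rep_eq (rep_emb _)
  (rep_add (rep_scale k (rep_emb v)) (rep_emb w)) _.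
Qed.

HB.instance Definition _ := GRing.isLinear.Build R[i] V completion _ emb embP.

Lemma rep_tends u x : cauchy_in u -> rep u x -> tends (emb \o u) x.
Proof.
move=> cu ux; apply/tendsP => e e0; have [N hN] := cu _ (divr_gt0 e0 (ltr0Sn R 1)).
exists N => n Nn /=.
have h : (fun m => p (u n - u m)) @ \oo --> rnorm (emb (u n) - x).
  have -> : x = - (-1 *: x) by rewrite scaleN1r opprK.
  rewrite opprK; under eq_fun do rewrite -scaleN1r.
  apply: rep_cnorm; apply: rep_add (rep_emb _) _; exact: rep_scale.
apply: (@le_lt_trans _ _ (e / 2)); last by lra.
apply: (cvgr_to_le h); exists N => // m Nm /=; exact/ltW/hN.
Qed.

Lemma completion_dense (x : completion) : exists u, tends (emb \o u) x.
Proof.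
by exists (cs (repr x)); apply: rep_tends (rep_repr x); exact: csP.
Qed.

(** For each n a Cauchy filter contains a ball of radius 1/(n+1) about the image of
    some v_n; these v_n form a Cauchy sequence, and its class is the limit. *)
Lemma completion_complete (F : set_system completion) :
  ProperFilter F -> cauchy F -> cvg F.
Proof.
move=> FF /cauchyP cF.
have ex n : exists v, F [set y : completion | rnorm (y - emb v) < n.+1%:R^-1].
  have n0 : 0 < n.+1%:R^-1 / 2 :> R by rewrite divr_gt0 // invr_gt0 ltr0n.
  have [x Fx] := cF ((n.+1%:R^-1 / 2)%:C%C) ltac:(by rewrite ltcR).
  have [u /tendsP/(_ _ n0)[N hN]] := completion_dense x.
  exists (u N); apply: filterS Fx => y; rewrite -ball_normE /ball_ /= rnormE ltcR.
  have := hN N (leqnn N) => /= h1 h2.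
  have := rnormD (y - x) (x - emb (u N)); rewrite addrA subrK => h3.
  rewrite rnormB in h1; rewrite rnormB in h2.
  by move: h1 h2 h3; set e := n.+1%:R^-1; lra.
pose v n := sval (cid (ex n)).
have Fv n : F [set y : completion | rnorm (y - emb (v n)) < n.+1%:R^-1].
  exact: svalP (cid (ex n)).
have d m n : p (v m - v n) <= m.+1%:R^-1 + n.+1%:R^-1.
  have [y [h1 h2]] := filter_ex (filterI (Fv m) (Fv n)).
  rewrite -rnorm_emb linearB /=.
  have := rnormD (emb (v m) - y) (y - emb (v n)); rewrite addrA subrK.
  move: h1 h2; rewrite /= (rnormB _ (emb (v m))).
  by set d := m.+1%:R^-1; set e := n.+1%:R^-1 => h1 h2 h3; lra.
have small e : 0 < e -> exists N, forall n, (N <= n)%N -> n.+1%:R^-1 < e :> R.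
  have [|h _] := @nullP R harmonic; first by move=> ?; rewrite invr_ge0.
  exact: h (@cvg_harmonic R) e.
have cv : cauchy_in v.
  move=> e e0; have [N hN] := small _ (divr_gt0 e0 (ltr0Sn R 1)).
  exists N => m n Nm Nn; apply: le_lt_trans (d m n) _.
  have := hN _ Nm; have := hN _ Nn.
  by set a := m.+1%:R^-1; set b := n.+1%:R^-1; lra.
apply/cvg_ex; exists (cls (CSeq cv)).
have /tendsP vx : tends (emb \o v) (cls (CSeq cv)).
  exact: (rep_tends cv (rep_cls (CSeq cv))).
apply/cvgrPdist_lt => _ /posC[e e0 ->].
have [N hN] := vx _ (divr_gt0 e0 (ltr0Sn R 1)).
have [M hM] := small _ (divr_gt0 e0 (ltr0Sn R 1)).
pose n := maxn N M.
apply: filterS (Fv n) => y /= h; rewrite rnormE ltcR rnormB.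
have := rnormD (y - emb (v n)) (emb (v n) - cls (CSeq cv)); rewrite addrA subrK.
have := hN n (leq_maxl _ _); have := hM n (leq_maxr _ _) => /=.
by move: h; set c := n.+1%:R^-1; lra.
Qed.

HB.instance Definition _ := Uniform_isComplete.Build completion
  completion_complete.
End Completion.

(** * Extension of bounded maps to the completion *)

Section Extension.
Context {R : realType}.

Lemma tends_rcauchy (V : normedModType R[i]) (u : nat -> V) x :
  tends u x -> rcauchy u.
Proof.
move=> /tendsP ux e e0; have [N hN] := ux _ (divr_gt0 e0 (ltr0Sn R 1)).
exists N => m n /hN hm /hN; rewrite rnormB => hn.
have := rnormD (u m - x) (x - u n); rewrite addrA subrK; lra.
Qed.

Lemma tends_near (V : normedModType R[i]) (u v : nat -> V) x :
  tends u x -> (fun n => rnorm (v n - u n)) @ \oo --> (0 : R) -> tends v x.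
Proof.
move=> ux vu; apply: null_le (null_add vu ux) => n; rewrite rnorm_ge0 /=.
by apply: le_trans (rnormD _ _); rewrite addrA subrK.
Qed.

Lemma tends_emb_near (V : lmodType R[i]) (p : seminorm V) (u v : nat -> V) x :
  tends (emb p \o u) x -> tends (emb p \o v) x ->
  (fun n => p (u n - v n)) @ \oo --> (0 : R).
Proof.
move=> ux vx; apply: null_le (null_add ux vx) => n; rewrite sn_ge0 /=.
rewrite -rnorm_emb linearB /=.
have := rnormD (emb p (u n) - x) (x - emb p (v n)); rewrite addrA subrK.
by rewrite (rnormB x).
Qed.

Lemma tends_sn (V : lmodType R[i]) (p : seminorm V) (u : nat -> V) x :
  tends (emb p \o u) x -> (fun n => p (u n)) @ \oo --> rnorm x.
Proof. by move=> /tends_norm; under eq_fun do rewrite /= rnorm_emb. Qed.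

(** The image of a representing sequence is Cauchy, and two sequences representing
    the same point have images at distance tending to 0; so the limit is a
    function of the point. *)
Lemma extension (V : lmodType R[i]) (p : seminorm V)
    (W : completeNormedModType R[i]) (f : V -> W) (C : R) :
  (forall v w, rnorm (f v - f w) <= C * p (v - w)) ->
  exists F : completion p -> W, forall u x,
    tends (emb p \o u) x -> tends (f \o u) (F x).
Proof.
move=> fC.
have ex x : exists y, exists2 u, tends (emb p \o u) x & tends (f \o u) y.
  have [u ux] := completion_dense x.
  have /rcauchy_tends[y fy] : rcauchy (f \o u); last by exists y, u.
  move=> e e0; have C0 : 0 < `|C| + 1 by have := normr_ge0 C; lra.
  have [N hN] := tends_rcauchy ux (divr_gt0 e0 C0).
  exists N => m n Nm Nn; have := hN _ _ Nm Nn.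
  rewrite /= -linearB rnorm_emb ltr_pdivlMr // => h.
  apply: le_lt_trans (fC _ _) _; apply: le_lt_trans h; rewrite mulrC.
  by have := ler_norm C; have := sn_ge0 p (u m - u n); nra.
exists (fun x => sval (cid (ex x))) => u x ux.
have [u0 u0x u0y] := svalP (cid (ex x)); apply: tends_near u0y _.
have := null_scale C (tends_emb_near ux u0x); apply: null_le => n.
by rewrite rnorm_ge0 /= fC.
Qed.

(** The bilinear analogue; representing sequences are bounded, so the images of
    pairs of them are again Cauchy. *)
Lemma extension2 (V1 V2 : lmodType R[i]) (p : seminorm V1) (q : seminorm V2)
    (W : completeNormedModType R[i]) (m : V1 -> V2 -> W) :
  (forall v w w', m v (w - w') = m v w - m v w') ->
  (forall v v' w, m (v - v') w = m v w - m v' w) ->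
  (forall v w, rnorm (m v w) <= p v * q w) ->
  exists M : completion p -> completion q -> W, forall u x v y,
    tends (emb p \o u) x -> tends (emb q \o v) y ->
    tends (fun n => m (u n) (v n)) (M x y).
Proof.
move=> mr ml mC.
have d v w v' w' : rnorm (m v w - m v' w') <= p (v - v') * q w + p v' * q (w - w').
  apply: le_trans (lerD (mC _ _) (mC _ _)); rewrite mr ml.
  by apply: le_trans (rnormD _ _); rewrite addrA subrK.
have bnd (V : lmodType R[i]) (r : seminorm V) u x : tends (emb r \o u) x ->
    exists N, forall n, (N <= n)%N -> r (u n) < rnorm x + 1.
  move=> /tendsP/(_ 1 ltr01)[N hN]; exists N => n /hN /= h.
  have := rnormD (emb r (u n) - x) x; rewrite subrK rnorm_emb; lra.
have ex x y : exists z, exists u v, [/\ tends (emb p \o u) x,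
    tends (emb q \o v) y & tends (fun n => m (u n) (v n)) z].
  have [u ux] := completion_dense x; have [v vy] := completion_dense y.
  have /rcauchy_tends[z fz] : rcauchy (fun n => m (u n) (v n)); last first.
    by exists z, u, v.
  move=> e e0; have [N1 h1] := bnd _ _ _ _ ux; have [N2 h2] := bnd _ _ _ _ vy.
  have x1 : 0 < 2 * (rnorm x + 1) by have := rnorm_ge0 x; lra.
  have y1 : 0 < 2 * (rnorm y + 1) by have := rnorm_ge0 y; lra.
  have [N3 h3] := tends_rcauchy ux (divr_gt0 e0 y1).
  have [N4 h4] := tends_rcauchy vy (divr_gt0 e0 x1).
  exists (maxn (maxn N1 N2) (maxn N3 N4)) => k n.
  rewrite !geq_max => /andP[/andP[k1 k2] /andP[k3 k4]].
  move=> /andP[/andP[n1 n2] /andP[n3 n4]].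
  have := h3 _ _ k3 n3; have := h4 _ _ k4 n4.
  rewrite /= -!linearB !rnorm_emb !ltr_pdivlMr // => h4' h3'.
  apply: le_lt_trans (d _ _ _ _) _.
  have := h1 _ n1; have := h2 _ k2.
  have := sn_ge0 p (u k - u n); have := sn_ge0 q (v k - v n).
  by have := sn_ge0 p (u n); have := sn_ge0 q (v k); nra.
exists (fun x y => sval (cid (ex x y))) => u x v y ux vy.
have [u0 [v0 [u0x v0y mz]]] := svalP (cid (ex x y)); apply: tends_near mz _.
have h1 := rlimM (tends_emb_near ux u0x) (tends_sn vy).
have h2 := rlimM (tends_sn u0x) (tends_emb_near vy v0y).
rewrite mul0r in h1; rewrite mulr0 in h2.
have h3 := null_add h1 h2.
apply: (null_le _ h3) => n.
by rewrite rnorm_ge0 d.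
Qed.
End Extension.

(** * Real inner products on complex spaces *)

(** The real part g of a semi-inner product determines it, as
    g x y + i g x (i y). The real parts are exactly the symmetric, positive,
    real-bilinear forms invariant under multiplication by i, and working with
    these keeps all the estimates in R. *)
Record rform (R : realType) (V : lmodType R[i]) := RForm {
  rf :> V -> V -> R ;
  rfC : forall x y, rf x y = rf y x ;
  rfDl : forall x y z, rf (x + y) z = rf x z + rf y z ;
  rfZl : forall (t : R) x y, rf (t%:C%C *: x) y = t * rf x y ;
  rfI : forall x y, rf ('i%C *: x) ('i%C *: y) = rf x y ;
  rf_ge0 : forall x, 0 <= rf x x }.

Section RealForms.
Context {R : realType} {V : lmodType R[i]} (g : rform V).

Lemma rfDr x y z : g x (y + z) = g x y + g x z.
Proof. by rewrite rfC rfDl !(rfC g x). Qed.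

Lemma rfZr (t : R) x y : g x (t%:C%C *: y) = t * g x y.
Proof. by rewrite rfC rfZl (rfC g x). Qed.

Lemma rfNl x y : g (- x) y = - g x y.
Proof.
have := rfZl g (-1) x y.
by rewrite rmorphN rmorph1 scaleN1r mulN1r.
Qed.

Lemma rfNr x y : g x (- y) = - g x y.
Proof. by rewrite rfC rfNl (rfC g x). Qed.

Lemma rfBl x y z : g (x - y) z = g x z - g y z.
Proof. by rewrite rfDl rfNl. Qed.

Lemma rfBr x y z : g x (y - z) = g x y - g x z.
Proof. by rewrite rfDr rfNr. Qed.

Lemma rf0l y : g 0 y = 0.
Proof. by rewrite -(subrr 0) rfBl subrr. Qed.

Lemma rf0r y : g y 0 = 0.
Proof. by rewrite rfC rf0l. Qed.

Lemma rf_suml (I : finType) (F : I -> V) y :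
  g (\sum_i F i) y = \sum_i g (F i) y.
Proof. by apply: (big_morph (fun x => g x y)) => [x z|]; rewrite ?rfDl ?rf0l. Qed.

Lemma rf_sumr (I : finType) (F : I -> V) y :
  g y (\sum_i F i) = \sum_i g y (F i).
Proof. by rewrite rfC rf_suml; apply: eq_bigr => i _; rewrite rfC. Qed.

Lemma iiE (x : V) : 'i%C *: ('i%C *: x) = - x.
Proof. by rewrite scalerA -expr2 sqr_i scaleN1r. Qed.

Lemma rfIl x y : g ('i%C *: x) y = - g x ('i%C *: y).
Proof. by rewrite -rfI iiE rfNl. Qed.

Lemma rfxI x : g x ('i%C *: x) = 0.
Proof. by have := rfIl x x; rewrite (rfC g _ x); lra. Qed.

Lemma scaleC (k : R[i]) (x : V) :
  k *: x = (complex.Re k)%:C%C *: x + (complex.Im k)%:C%C *: ('i%C *: x).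
Proof. by rewrite {1}(complexE k) scalerDl scalerA mulrC. Qed.

Lemma rf_scale (k : R[i]) x : g (k *: x) (k *: x) = rabs k ^+ 2 * g x x.
Proof.
rewrite rabs_sqr scaleC rfDl !rfDr !rfZl !rfZr rfI rfxI.
by rewrite (rfC g _ x) rfxI; ring.
Qed.

(** The discriminant of t |-> g (x + t y) (x + t y) is not positive; the value of t
    used when g y y = 0 makes that affine function negative. *)
Lemma rf_CS x y : g x y ^+ 2 <= g x x * g y y.
Proof.
have h (t : R) : 0 <= g x x + 2 * t * g x y + t ^+ 2 * g y y.
  have := rf_ge0 g (x + t%:C%C *: y).
  by rewrite rfDl !rfDr !rfZl !rfZr (rfC g y x); nra.
have xx := rf_ge0 g x; have yy := rf_ge0 g y.
have [y0|y0] := eqVneq (g y y) 0.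
  have [->|xy] := eqVneq (g x y) 0; first by rewrite y0 expr0n mulr0.
  have := h (- (g x x + 1) / (2 * g x y)).
  have -> : 2 * (- (g x x + 1) / (2 * g x y)) * g x y = - (g x x + 1).
    by field.
  by rewrite y0; lra.
have yp : 0 < g y y by rewrite lt_def y0.
have := h (- g x y / g y y).
have -> : g x x + 2 * (- g x y / g y y) * g x y + (- g x y / g y y) ^+ 2 * g y y
  = (g x x * g y y - g x y ^+ 2) / g y y by field.
by rewrite pmulr_lge0 ?invr_gt0 // subr_ge0.
Qed.

Definition rf_norm x := Num.sqrt (g x x).

Lemma rf_abs_le x y : `|g x y| <= rf_norm x * rf_norm y.
Proof. by rewrite -sqrtrM ?rf_ge0 // -sqrtr_sqr ler_wsqrtr // rf_CS. Qed.

Lemma rf_normD x y : rf_norm (x + y) <= rf_norm x + rf_norm y.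
Proof.
have h := rf_abs_le x y.
have x0 : 0 <= rf_norm x := sqrtr_ge0 _.
have y0 : 0 <= rf_norm y := sqrtr_ge0 _.
rewrite -(@ler_pXn2r _ 2) ?nnegrE ?addr_ge0 ?sqrtr_ge0 //.
rewrite sqrrD !sqr_sqrtr ?rf_ge0 // rfDl !rfDr (rfC g y x).
by have := ler_norm (g x y); lra.
Qed.

Lemma rf_normZ k x : rf_norm (k *: x) = rabs k * rf_norm x.
Proof.
by rewrite /rf_norm rf_scale sqrtrM ?sqr_ge0 // sqrtr_sqr ger0_norm ?rabs_ge0.
Qed.

Definition form_seminorm := Seminorm rf_normD rf_normZ.

Lemma form_seminorm_sqr x : form_seminorm x ^+ 2 = g x x.
Proof. by rewrite sqr_sqrtr ?rf_ge0. Qed.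

Lemma polarization x y :
  g x y = (form_seminorm (x + y) ^+ 2 - form_seminorm (x - y) ^+ 2) / 4.
Proof.
rewrite !form_seminorm_sqr rfBl !rfBr rfDl !rfDr (rfC g y x).
by field.
Qed.

Definition hcompletion := completion form_seminorm.
HB.instance Definition _ := CompleteNormedModule.on hcompletion.

(** Defined by polarization, so that its continuity is that of the norm. *)
Definition cform (x y : hcompletion) : R :=
  (rnorm (x + y) ^+ 2 - rnorm (x - y) ^+ 2) / 4.

Local Notation e := (emb form_seminorm).

Lemma rlim_sqr (f : nat -> R) (a : R) :
  f @ \oo --> a -> (fun n => f n ^+ 2) @ \oo --> a ^+ 2.
Proof. by move=> fa; have := rlimM fa fa. Qed.

Lemma cform_lim u v x y : tends (e \o u) x -> tends (e \o v) y ->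
  (fun n => g (u n) (v n)) @ \oo --> cform x y.
Proof.
move=> ux vy.
have h1 : tends (e \o (fun n => u n + v n)) (x + y).
  by apply: tends_eq (tendsD ux vy) => n /=; rewrite linearD.
have h2 : tends (e \o (fun n => u n - v n)) (x - y).
  rewrite -scaleN1r; apply: tends_eq (tendsD ux (tendsZ (-1) vy)) => n /=.
  by rewrite linearB scaleN1r.
have h3 := rlimB (rlim_sqr (tends_sn h1)) (rlim_sqr (tends_sn h2)).
rewrite /cform mulrC; apply: rlim_eq (rlimZ (c := 4^-1) h3) => n.
by rewrite polarization mulrC.
Qed.

Lemma cform_emb v w : cform (e v) (e w) = g v w.
Proof.
have h := cform_lim (tends_cst (e v) : tends (e \o (fun=> v)) _)
  (tends_cst (e w) : tends (e \o (fun=> w)) _).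
by apply: (rlim_uniq h); apply: cvg_cst.
Qed.

Lemma cformC x y : cform x y = cform y x.
Proof. by rewrite /cform (addrC x y) (rnormB x y). Qed.

Lemma cformxx x : cform x x = rnorm x ^+ 2.
Proof.
rewrite /cform subrr rnorm0 -mulr2n -scaler_nat rnormZ.
by rewrite /rabs normr_nat /= ; field.
Qed.

Lemma cformD x y z : cform (x + y) z = cform x z + cform y z.
Proof.
have [u ux] := completion_dense x; have [v vy] := completion_dense y.
have [w wz] := completion_dense z.
have h : tends (e \o (fun n => u n + v n)) (x + y).
  by apply: tends_eq (tendsD ux vy) => n /=; rewrite linearD.
apply: rlim_uniq (cform_lim h wz) _.
under eq_fun do rewrite rfDl.
exact: rlimD (cform_lim ux wz) (cform_lim vy wz).
Qed.

Lemma tends_embZ k u (x : hcompletion) : tends (e \o u) x ->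
  tends (e \o (fun n => k *: u n)) (k *: x).
Proof.
by move=> /(tendsZ k); apply: tends_eq => n /=; rewrite linearZ.
Qed.

Lemma cformZ (t : R) x y : cform (t%:C%C *: x) y = t * cform x y.
Proof.
have [u ux] := completion_dense x; have [v vy] := completion_dense y.
apply: rlim_uniq (cform_lim (tends_embZ _ ux) vy) _.
under eq_fun do rewrite rfZl.
exact: rlimZ (cform_lim ux vy).
Qed.

Lemma cformI x y : cform ('i%C *: x) ('i%C *: y) = cform x y.
Proof.
by rewrite /cform -scalerDr -scalerBr !rnormZ /rabs normc_def /= expr0n expr1n
  add0r sqrtr1 !mul1r.
Qed.

Lemma cform_ge0 x : 0 <= cform x x.
Proof. by rewrite cformxx sqr_ge0. Qed.

Definition cform_rform : rform hcompletion :=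
  RForm cformC cformD cformZ cformI cform_ge0.
End RealForms.

Section ComplexForm.
Context {R : realType} {V : lmodType R[i]} (g : rform V).

(** The complex form of which g is the real part. *)
Definition cplx_form (x y : V) : R[i] := Complex (g x y) (g x ('i%C *: y)).

Lemma cplx_formDl x y z : cplx_form (x + y) z = cplx_form x z + cplx_form y z.
Proof. by rewrite /cplx_form !rfDl. Qed.

Lemma cplx_formDr x y z : cplx_form z (x + y) = cplx_form z x + cplx_form z y.
Proof. by rewrite /cplx_form scalerDr !rfDr. Qed.

Lemma cplx_formZl k x y : cplx_form (k *: x) y = k * cplx_form x y.
Proof.
rewrite /cplx_form (scaleC k x) !rfDl !rfZl !rfIl iiE rfNr.
case: k => a b; apply/eqP; rewrite eq_complex /=; apply/andP; split; apply/eqP; ring.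
Qed.

Lemma cplx_formJ x y : cplx_form x y = (cplx_form y x)^*.
Proof.
apply/eqP; rewrite eq_complex /= rfC eqxx /=.
by rewrite (rfC g x) rfIl.
Qed.
End ComplexForm.

(** * Hilbert spaces *)

Section HilbertCompletion.
Context {R : realType} {V : lmodType R[i]} (g : rform V).

Definition hcdot (x y : hcompletion g) : R[i] := cplx_form (cform_rform g) x y.

Fact hcdot_bilinear :
  bilinear_for ( *%R : GRing.Scale.law R[i] R[i])
    (@Num.conj R[i] \; *%R : GRing.Scale.law R[i] R[i]) hcdot.
Proof.
split => [y k x z|x k y z].
  by rewrite /hcdot cplx_formDl cplx_formZl.
by rewrite /hcdot cplx_formDr [cplx_form _ _ (k *: y)]cplx_formJ cplx_formZl
  rmorphM [in RHS]cplx_formJ.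
Qed.

HB.instance Definition _ := bilinear_isBilinear.Build R[i]
  (hcompletion g) (hcompletion g) R[i] ( *%R) (@Num.conj R[i] \; *%R) hcdot
  hcdot_bilinear.

Fact hcdot_hermitian x y : hcdot x y = (-1) ^+ false * (hcdot y x)^*.
Proof. by rewrite expr0 mul1r /hcdot cplx_formJ. Qed.

HB.instance Definition _ := isHermitianSesquilinear.Build R[i] (hcompletion g)
  false (@Num.conj R[i]) hcdot hcdot_hermitian.

Fact hcdotE (x : hcompletion g) : hcdot x x = `|x| ^+ 2.
Proof.
rewrite rnormE -rmorphXn /= -cformxx /hcdot /cplx_form rfxI.
by apply/eqP; rewrite eq_complex /= !eqxx.
Qed.

Fact hcdot_gt0 (x : hcompletion g) : x != 0 -> 0 < hcdot x x.
Proof. by move=> x0; rewrite hcdotE exprn_gt0 // normr_gt0. Qed.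

HB.instance Definition _ := isDotProduct.Build R[i] (hcompletion g) hcdot hcdot_gt0.

HB.instance Definition _ := CompleteNormedModule_isHilbert.Build R
  (hcompletion g) (hcdotE : forall x, (hcdot : {dot _ for _}) x x = _).
End HilbertCompletion.

Section HilbertForm.
Context {R : realType} {H : hilbertType R}.
Implicit Types x y z : H.

Definition rdot x y : R := complex.Re (hdot x y).

Lemma hdotJ x y : hdot x y = (hdot y x)^*.
Proof.
by have := hermitian_subproof (s := hdot) x y; rewrite expr0 mul1r.
Qed.

Lemma rdotC x y : rdot x y = rdot y x.
Proof. by rewrite /rdot hdotJ; case: (hdot y x). Qed.

Lemma hdotDl x y z : hdot (x + y) z = hdot x z + hdot y z.
Proof. exact: (linearDl hdot). Qed.

Lemma hdotZl k x y : hdot (k *: x) y = k * hdot x y.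
Proof. exact: (linearZl_LR hdot). Qed.

Lemma hdotZr k x y : hdot x (k *: y) = k^* * hdot x y.
Proof. exact: (linearZr_LR hdot). Qed.

Lemma rdotD x y z : rdot (x + y) z = rdot x z + rdot y z.
Proof. by rewrite /rdot hdotDl raddfD. Qed.

Lemma rdotZ (t : R) x y : rdot (t%:C%C *: x) y = t * rdot x y.
Proof.
rewrite /rdot hdotZl; case: (hdot x y) => a b /=; ring.
Qed.

Lemma rdotI x y : rdot ('i%C *: x) ('i%C *: y) = rdot x y.
Proof.
rewrite /rdot hdotZl hdotZr; case: (hdot x y) => a b /=; ring.
Qed.

Lemma rdotxx x : rdot x x = rnorm x ^+ 2.
Proof. by rewrite /rdot hdotE rnormE -rmorphXn. Qed.

Lemma rdot_ge0 x : 0 <= rdot x x.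
Proof. by rewrite rdotxx sqr_ge0. Qed.

Definition hform : rform H := RForm rdotC rdotD rdotZ rdotI rdot_ge0.

Lemma hdot_cplx x y : hdot x y = cplx_form hform x y.
Proof.
rewrite /cplx_form /= /rdot hdotZr.
by case: (hdot x y) => a b; apply/eqP; rewrite eq_complex /=; apply/andP; split;
  apply/eqP; ring.
Qed.
End HilbertForm.

(** * Square roots in a C*-algebra *)

Section SquareRoot.
Context {R : realType} {M : lmodType R[i]} (P : seminorm M) (mul : M -> M -> M).
Hypothesis mulBl : forall x y z, mul (x - y) z = mul x z - mul y z.
Hypothesis mulBr : forall x y z, mul x (y - z) = mul x y - mul x z.
Hypothesis mulP : forall x y, P (mul x y) <= P x * P y.
Variable h : M.

(** A solution d of h = 2 d - d^2 makes 1 - d a square root of 1 - h. It is the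
    fixed point of d |-> (h + d^2) / 2, which for P h <= r < 1 maps the ball of
    radius r to itself and contracts distances there by the factor r. It is
    stated for any bounded product so as to serve both for an algebra and for the
    matrices over it. *)
Fixpoint sqrt_iter (k : nat) : M :=
  if k is k'.+1
  then (2^-1)%:C%C *: (h + mul (sqrt_iter k') (sqrt_iter k')) else 0.

Variable r : R.
Hypotheses (hr : P h <= r) (r1 : r < 1).

Let r0 : 0 <= r. Proof. exact: le_trans (sn_ge0 _ _) hr. Qed.

Lemma halfP x : P ((2^-1)%:C%C *: x) = P x / 2.
Proof. by rewrite snZ rabsR ger0_norm ?invr_ge0 // mulrC. Qed.

Lemma sqrt_iter_le k : P (sqrt_iter k) <= r.
Proof.
elim: k => [|k IH] /=; first by rewrite sn0.
rewrite halfP; have := snD P h (mul (sqrt_iter k) (sqrt_iter k)).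
have := le_trans (mulP _ _) (ler_pM (sn_ge0 P _) (sn_ge0 P _) IH IH).
have : r * r <= r by rewrite ler_piMr // ltW.
have := hr; lra.
Qed.

Lemma sqrt_step_contract x y : P x <= r -> P y <= r ->
  P ((2^-1)%:C%C *: (h + mul y y) - (2^-1)%:C%C *: (h + mul x x))
    <= r * P (y - x).
Proof.
move=> xr yr; rewrite -scalerBr opprD addrACA subrr add0r halfP.
have -> : mul y y - mul x x = mul y (y - x) + mul (y - x) x.
  by rewrite mulBr mulBl addrA subrK.
have := snD P (mul y (y - x)) (mul (y - x) x).
have := le_trans (mulP y (y - x)) (ler_wpM2r (sn_ge0 P _) yr).
have := le_trans (mulP (y - x) x) (ler_wpM2l (sn_ge0 P _) xr).
lra.
Qed.

Lemma sqrt_iter_geom k : P (sqrt_iter k.+1 - sqrt_iter k) <= r ^+ k.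
Proof.
elim: k => [|k IH].
  by rewrite subr0 expr0; apply: le_trans (sqrt_iter_le 1) (ltW r1).
apply: le_trans (sqrt_step_contract (sqrt_iter_le k) (sqrt_iter_le k.+1)) _.
by rewrite exprS ler_wpM2l.
Qed.

Lemma sqrt_iter_tail n m :
  (1 - r) * P (sqrt_iter (m + n) - sqrt_iter n) <= r ^+ n - r ^+ (m + n).
Proof.
elim: m => [|m IH]; first by rewrite !add0n !subrr sn0 mulr0.
have := snD P (sqrt_iter (m + n).+1 - sqrt_iter (m + n))
  (sqrt_iter (m + n) - sqrt_iter n).
rewrite addrA subrK addSn => h1.
have h2 := sqrt_iter_geom (m + n).
have r1' : 0 <= 1 - r by rewrite subr_ge0 ltW.
have := ler_wpM2l r1' (le_trans h1 (lerD h2 (lexx _))).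
by rewrite exprS mulrDr; move: IH; lra.
Qed.

Lemma sqrt_iter_cauchy : cauchy_in P sqrt_iter.
Proof.
move=> e e0; have r1' : 0 < 1 - r by rewrite subr_gt0.
have rn : (fun n => r ^+ n) @ \oo --> (0 : R).
  by apply: cvg_expr; rewrite ger0_norm.
have [|hN _] := @nullP R (fun n => r ^+ n); first by move=> n; rewrite exprn_ge0.
have [N {}hN] := hN rn _ (mulr_gt0 r1' e0).
have H k n : (N <= n)%N -> (n <= k)%N -> P (sqrt_iter k - sqrt_iter n) < e.
  move=> Nn nk; have := sqrt_iter_tail n (k - n); rewrite subnK // => h1.
  rewrite -(ltr_pM2l r1'); apply: le_lt_trans h1 _.
  by have := hN n Nn; have := exprn_ge0 k r0; lra.
exists N => m n Nm Nn; case: (leqP m n) => [mn|/ltnW nm]; last exact: H.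
by rewrite snB H.
Qed.
End SquareRoot.

Section CStarBasics.
Context {R : realType} {A : cstarType R}.
Implicit Types a b c : A.

Lemma conjR (t : R) : (t%:C%C)^* = t%:C%C.
Proof. exact: conjc_real. Qed.

Lemma cmulDl a b c : cmul (a + b) c = cmul a c + cmul b c.
Proof. exact: (linD (cmul_linearl c)). Qed.

Lemma cmulDr a b c : cmul c (a + b) = cmul c a + cmul c b.
Proof. exact: (linD (cmul_linearr c)). Qed.

Lemma cmulZl k a c : cmul (k *: a) c = k *: cmul a c.
Proof. exact: (linZ (cmul_linearl c)). Qed.

Lemma cmulZr k a c : cmul c (k *: a) = k *: cmul c a.
Proof. exact: (linZ (cmul_linearr c)). Qed.

Lemma cmulBl a b c : cmul (a - b) c = cmul a c - cmul b c.
Proof. exact: (linB (cmul_linearl c)). Qed.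

Lemma cmulBr a b c : cmul c (a - b) = cmul c a - cmul c b.
Proof. exact: (linB (cmul_linearr c)). Qed.

Lemma cmul0 a : cmul a 0 = 0.
Proof. exact: (lin0 (cmul_linearr a)). Qed.

Lemma cmul_rnorm a b : rnorm (cmul a b) <= rnorm a * rnorm b.
Proof. by rewrite -lecR rmorphM /= -!rnormE cmul_norm. Qed.

Lemma cstar_rnorm a : rnorm (cmul (star a) a) = rnorm a ^+ 2.
Proof. by apply: complexI; rewrite rmorphXn /= -!rnormE cstar_norm. Qed.

Lemma star_rnorm a : rnorm (star a) = rnorm a.
Proof.
have h b : rnorm b <= rnorm (star b).
  have := cmul_rnorm (star b) b; rewrite cstar_rnorm.
  have [->|b0] := eqVneq (rnorm b) 0; first by rewrite rnorm_ge0.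
  have b1 : 0 < rnorm b by rewrite lt_def b0 rnorm_ge0.
  by rewrite expr2 ler_pM2r.
by apply/eqP; rewrite eq_le h andbT; have := h (star a); rewrite starK.
Qed.

Lemma starB a b : star (a - b) = star a - star b.
Proof.
by rewrite -scaleN1r starD starZ rmorphN rmorph1 scaleN1r.
Qed.

Lemma star0 : star (0 : A) = 0.
Proof. by have := starB 0 0; rewrite !subrr. Qed.

Lemma star_one : star (cone : A) = cone.
Proof. by rewrite -[LHS]cmul1a -{1}(starK (cone : A)) -starM cmul1a starK. Qed.

Lemma tends_cmul (u v : nat -> A) a b : tends u a -> tends v b ->
  tends (fun n => cmul (u n) (v n)) (cmul a b).
Proof.
move=> ua vb.
have h := rlimD (rlimM ua (tends_norm vb)) (rlimZ (c := rnorm a) vb).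
rewrite mul0r mulr0 addr0 in h.
apply: null_le h => n; rewrite rnorm_ge0 /=.
apply: le_trans (lerD (cmul_rnorm _ _) (cmul_rnorm _ _)).
by rewrite cmulBl cmulBr; apply: le_trans (rnormD _ _); rewrite addrA subrK.
Qed.

Lemma tends_star (u : nat -> A) a : tends u a -> tends (star \o u) (star a).
Proof. by apply: null_le => n; rewrite rnorm_ge0 /= -starB star_rnorm. Qed.

Definition norm_seminorm := Seminorm (@rnormD R A) (@rnormZ R A).

(** This replaces the functional calculus: once a *-representation is applied,
    1 - h becomes the square of the self-adjoint operator 1 - d, hence positive,
    even if the representation does not preserve the unit. *)
Lemma quasi_sqrt (h : A) : star h = h -> rnorm h < 1 ->
  exists d, star d = d /\ h = 2%:C%C *: d - cmul d d.
Proof.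
move=> hs h1.
have /rcauchy_tends[d hd] : rcauchy (sqrt_iter (@cmul R A) h).
  exact: (@sqrt_iter_cauchy _ _ norm_seminorm (@cmul R A) (fun x y z => cmulBl x y z)
    (fun x y z => cmulBr y z x) cmul_rnorm h (rnorm h)).
exists d; split.
  apply: (tends_unique _ hd); apply: tends_eq (tends_star hd) => n /=.
  elim: n => [|n IH] /=; first exact: star0.
  by rewrite starZ starD starM IH hs conjR.
have hd1 := tends_shift hd.
have hd2 := tendsZ (2^-1)%:C%C (tendsD (tends_cst h) (tends_cmul hd hd)).
rewrite {1}(tends_unique hd1 hd2) scalerA -rmorphM divff ?pnatr_eq0 //.
by rewrite scale1r addrK.
Qed.
End CStarBasics.

(** * Representations on pre-Hilbert spaces and the GNS construction *)

(** A *-representation on a space with a semi-inner product, prior to separation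
    and completion. *)
Definition star_module (R : realType) (A : cstarType R) (V : lmodType R[i])
    (g : rform V) (act : A -> V -> V) : Prop :=
  [/\ forall v, linear (act ^~ v),
      forall a, linear (act a),
      forall a b v, act (cmul a b) v = act a (act b v) &
      forall a v w, g (act a v) w = g v (act (star a) w)].

Section StarModules.
Context {R : realType} {A : cstarType R} {V : lmodType R[i]} (g : rform V).
Variable act : A -> V -> V.
Hypothesis actP : star_module g act.

Lemma actBl a b v : act (a - b) v = act a v - act b v.
Proof. by have [h _ _ _] := actP; exact: (linB (h v)). Qed.

Lemma actZl k a v : act (k *: a) v = k *: act a v.
Proof. by have [h _ _ _] := actP; exact: (linZ (h v)). Qed.

Lemma actBr a v w : act a (v - w) = act a v - act a w.
Proof. by have [_ h _ _] := actP; exact: (linB (h a)). Qed.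

(** If the norm of b is less than 1 then star b * b = 2 d - d^2 with d self-adjoint,
    and g v v - g (b v) (b v) = g (v - d v) (v - d v) is not negative. *)
Lemma act_contractive a v :
  form_seminorm g (act a v) <= rnorm a * form_seminorm g v.
Proof.
have [_ _ actM actS] := actP.
apply: le_mul_lim => [|t]; first exact: sn_ge0.
move=> at_; have t0 : 0 < t := le_lt_trans (rnorm_ge0 a) at_.
pose b := (t^-1)%:C%C *: a.
have -> : act a v = t%:C%C *: act b v.
  by rewrite /b actZl scalerA -rmorphM mulfV ?gt_eqF // scale1r.
rewrite snZ rabsR (gtr0_norm t0) ler_pM2l //.
have [||d [ds dh]] := @quasi_sqrt R A (cmul (star b) b).
- by rewrite starM starK.
- rewrite cstar_rnorm /b rnormZ rabsR gtr0_norm ?invr_gt0 // exprMn_comm.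
    by rewrite -exprMn expr_lt1 // ?mulr_ge0 ?invr_ge0 ?rnorm_ge0 ?ltW //
      mulrC ltr_pdivrMr // mul1r.
  exact: mulrC.
rewrite -(@ler_pXn2r _ 2) ?nnegrE ?sn_ge0 // !form_seminorm_sqr.
rewrite -subr_ge0 actS -actM dh actBl actZl actM.
have := rf_ge0 g (v - act d v).
rewrite !rfBl !rfBr rfZr (rfC g (act d v) v) (actS d v (act d v)) ds; lra.
Qed.

(** By [act_contractive] the action extends to the completion. *)
Lemma gns : exists s : A -> hcompletion g -> hcompletion g, star_rep s /\
  forall a v, s a (emb (form_seminorm g) v) = emb (form_seminorm g) (act a v).
Proof.
have [actlin actlinr actM actS] := actP.
pose e : V -> hcompletion g := emb (form_seminorm g).
have ex a : exists F : hcompletion g -> hcompletion g, forall u x,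
    tends (e \o u) x -> tends (e \o (act a \o u)) (F x).
  apply: (@extension _ _ _ (hcompletion g) (e \o act a) (rnorm a)) => v w /=.
  by rewrite -linearB /= rnorm_emb -actBr act_contractive.
pose s a := sval (cid (ex a)).
have sP a u x : tends (e \o u) x -> tends (e \o (act a \o u)) (s a x).
  exact: (svalP (cid (ex a))).
have sE a v : s a (e v) = e (act a v).
  have h : tends (e \o (fun=> v)) (e v) by exact: tends_cst.
  have h2 : tends (e \o (act a \o (fun=> v))) (e (act a v)).
    exact: (tends_cst (e (act a v))).
  exact: (tends_unique (sP a _ _ h) h2).
have dense (x : hcompletion g) : exists u, tends (e \o u) x := completion_dense x.
have comb k x y u v : tends (e \o u) x -> tends (e \o v) y ->
    tends (e \o (fun n => k *: u n + v n)) (k *: x + y : hcompletion g).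
  move=> ux vy; apply: tends_eq (tendsD (tendsZ k ux) vy) => n /=.
  exact/esym/embP.
have slin a : linear (s a).
  move=> k x y; have [u ux] := dense x; have [v vy] := dense y.
  apply: (tends_unique (sP a _ _ (comb k _ _ _ _ ux vy))).
  apply: tends_eq (comb k _ _ _ _ (sP a _ _ ux) (sP a _ _ vy)) => n /=.
  by rewrite actlinr.
exists s; split; last exact: sE.
split.
- move=> a; split => //; exists (rnorm a)%:C%C => x.
  rewrite !rnormE -rmorphM lecR; have [u ux] := dense x.
  apply: rlim_le (tends_sn (sP a _ _ ux)) (rlimZ (c := rnorm a) (tends_sn ux)) _.
  by move=> n /=; exact: act_contractive.
- move=> k a b; apply/funext => x; have [u ux] := dense x.
  apply: (tends_unique (sP _ _ _ ux)).
  apply: tends_eq (comb k _ _ _ _ (sP a _ _ ux) (sP b _ _ ux)) => n /=.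
  by rewrite actlin.
- move=> a b; apply/funext => x; have [u ux] := dense x.
  apply: (tends_unique (sP _ _ _ ux)).
  by apply: tends_eq (sP a _ _ (sP b _ _ ux)) => n /=; rewrite actM.
- move=> a.
  have H x y : cform (s a x) y = cform x (s (star a) y).
    have [u ux] := dense x; have [v vy] := dense y.
    apply: rlim_uniq (cform_lim (sP a _ _ ux) vy) _.
    by apply: rlim_eq (cform_lim ux (sP (star a) _ _ vy)) => n /=; rewrite actS.
  move=> x y; rewrite /hdot /= /hcdot /cplx_form /= !H.
  by rewrite (linZ (slin (star a))).
Qed.
End StarModules.

Section Representations.
Context {R : realType} {A : cstarType R} {H : hilbertType R}.
Variable s : A -> H -> H.
Hypothesis sP : star_rep s.

Lemma star_rep_module : star_module (@hform R H) s.
Proof.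
have [sb sl sM sS] := sP; split.
- by move=> v k a b; rewrite sl.
- by move=> a; have [] := sb a.
- by move=> a b v; rewrite sM.
- by move=> a x y /=; rewrite /rdot sS.
Qed.

Lemma hform_norm (x : H) : form_seminorm (@hform R H) x = rnorm x.
Proof.
by rewrite /= /rf_norm /= rdotxx sqrtr_sqr ger0_norm ?rnorm_ge0.
Qed.

Lemma star_rep_contractive a x : rnorm (s a x) <= rnorm a * rnorm x.
Proof. by rewrite -!hform_norm; exact: act_contractive star_rep_module a x. Qed.
End Representations.

(** * Extreme points of compact sets of real functions *)

Section ExtremePoints.
Context {R : realType} {X : eqType}.

Definition ptw := prod_topology (fun _ : X => R).

Definition mix (g g1 g2 : X -> R) (t : R) :=
  0 < t < 1 /\ forall x, g x = t * g1 x + (1 - t) * g2 x.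

Definition affine (f : ptw -> R) := forall g g1 g2 t, mix g g1 g2 t ->
  f g = t * f g1 + (1 - t) * f g2.

Variable K : set ptw.
Hypothesis cK : compact K.

Definition face (F : set ptw) := [/\ F `<=` K, closed F, F !=set0 &
  forall g g1 g2 t, F g -> K g1 -> K g2 -> mix g g1 g2 t -> F g1 /\ F g2].

Lemma eval_continuous (x : X) : continuous (fun g : ptw => g x).
Proof. exact: (@proj_continuous X (fun=> R) x). Qed.

Lemma eval_affine x : affine (fun g => g x).
Proof. by move=> g g1 g2 t [_]. Qed.

Lemma closed_ge_fun (f : ptw -> R) (a : R) : continuous f ->
  closed [set g | a <= f g].
Proof.
by move=> fc; apply: (@closed_comp _ _ f [set x | a <= x]) => // x _; exact: fc.
Qed.

Lemma max_face (F : set ptw) (f : ptw -> R) : face F -> continuous f ->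
  affine f -> face [set g | F g /\ forall g', F g' -> f g' <= f g].
Proof.
move=> [FK clF F0 Fface] fc fa.
have cF : compact F := subclosed_compact clF cK FK.
have [c /set_mem Fc cmax] := compact_EVT_max F0 cF (continuous_subspaceT fc).
have -> : [set g | F g /\ forall g', F g' -> f g' <= f g] =
    F `&` [set g | f c <= f g].
  apply/seteqP; split => g /= [Fg h]; split => //; first exact: h.
  by move=> g' Fg'; apply: le_trans h; apply: cmax; rewrite inE.
split.
- by move=> g [/FK].
- by apply: closedI => //; exact: closed_ge_fun.
- by exists c; split => /=.
- move=> g g1 g2 t [Fg /= cg] K1 K2 gmix.
  have [F1 F2] := Fface _ _ _ _ Fg K1 K2 gmix.
  have e := fa _ _ _ _ gmix; have [/andP[t0 t1] _] := gmix.
  have := cmax _ (mem_set F1); have := cmax _ (mem_set F2) => h2 h1.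
  suff : f c <= f g1 /\ f c <= f g2 by move=> [? ?]; split.
  have t1' : 0 < 1 - t by lra.
  have : t * (f c - f g1) + (1 - t) * (f c - f g2) <= 0 by rewrite e in cg; lra.
  have p1 : 0 <= t * (f c - f g1) by rewrite mulr_ge0 ?subr_ge0 // ltW.
  have p2 : 0 <= (1 - t) * (f c - f g2) by rewrite mulr_ge0 ?subr_ge0 // ltW.
  move=> p; have : t * (f c - f g1) <= 0 by lra.
  have : (1 - t) * (f c - f g2) <= 0 by lra.
  by rewrite !pmulr_rle0 // !subr_le0.
Qed.

(** The members of the chain generate a proper filter, which clusters in K by
    compactness; the cluster point lies in every member. *)
Lemma chain_face (C : set (set ptw)) F0 : face F0 -> C F0 -> C `<=` face ->
  total_on C subset -> face (\bigcap_(F in C) F).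
Proof.
move=> fF0 CF0 Cface Ctot.
pose G : set_system ptw := [set S | exists2 F, C F & F `<=` S].
have FG : ProperFilter G.
  split; first by move=> [F /Cface[_ _ [g Fg] _]] /(_ g Fg).
  split.
  - by exists F0.
  - move=> S1 S2 [F1 C1 s1] [F2 C2 s2].
    by have [h|h] := Ctot _ _ C1 C2; [exists F1|exists F2] => // g Fg; split; auto.
  - by move=> S1 S2 s12 [F1 C1 s1]; exists F1 => //; apply: subset_trans s12.
have [F0K _ _ _] := fF0.
have [g [Kg gG]] := cK FG (ex_intro2 _ _ F0 CF0 F0K).
split.
- by move=> h /(_ F0 CF0)/F0K.
- by apply: closed_bigI => F /Cface[].
- exists g => F CF; have [_ clF _ _] := Cface _ CF.
  apply: clF => U Ug; apply: gG => //; by exists F.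
- move=> h h1 h2 t Ch K1 K2 hm.
  split => F CF; have [_ _ _ fF] := Cface _ CF;
    by have [] := fF _ _ _ _ (Ch _ CF) K1 K2 hm.
Qed.

(** The argument of Krein and Milman: the maximizers of f form a closed face, and
    by compactness and Zorn's lemma it contains a minimal closed face. On a
    minimal face every evaluation is constant, since its maximizers form a
    face; so that face is a point, and this point is extreme. *)
Lemma extreme_max (f : ptw -> R) : closed K -> K !=set0 -> continuous f ->
  affine f -> exists g, [/\ K g, forall g', K g' -> f g' <= f g &
    forall g1 g2 t, K g1 -> K g2 -> mix g g1 g2 t -> g1 = g].
Proof.
move=> clK K0 fc fa.
have fK : face K by split => // *; split.
have fF0 := max_face fK fc fa.
set F0 := (X in face X) in fF0.
pose S := {F : set ptw | face F /\ F `<=` F0}.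
pose t0 : S := exist _ F0 (conj fF0 (@subset_refl _ F0)).
pose le (s t : S) : bool := `[< sval t `<=` sval s >].
have [||C Ctot|[F [fF FF0]] Fmax] := @ZL_preorder S t0 le.
- by move=> t; apply/asboolP.
- move=> r s t /asboolP rs /asboolP st; apply/asboolP.
  exact: subset_trans st rs.
- have [[s Cs]|C0] := pselect (exists s, C s); last first.
    by exists t0 => s Cs; case: C0; exists s.
  have fC : face (\bigcap_(F in [set sval s | s in C]) F).
    apply: (@chain_face _ (sval s)); first by have [] := svalP s.
    + by exists s.
    + by move=> _ [r Cr <-]; have [] := svalP r.
    + move=> _ _ [r1 C1 <-] [r2 C2 <-].
      by have [/asboolP h|/asboolP h] := Ctot _ _ C1 C2; [right|left].
  have sC : \bigcap_(F in [set sval s | s in C]) F `<=` F0.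
    move=> g /(_ (sval s)) h; have [_] := svalP s; apply; apply: h; by exists s.
  exists (exist _ (\bigcap_(F in [set sval s | s in C]) F) (conj fC sC) : S).
  move=> r Cr; apply/asboolP => g /= h.
  by apply: h; exists r.
have [FK _ [g Fg] Ff] := fF.
have single g' : F g' -> g' = g.
  suff le2 x h h' : F h -> F h' -> h x <= h' x.
    by move=> Fg'; apply/funext => x; apply/eqP; rewrite eq_le !le2.
  move=> Fh Fh'; have fM := max_face fF (@eval_continuous x) (@eval_affine x).
  have MF0 : [set g | F g /\ forall g', F g' -> g' x <= g x] `<=` F0.
    by move=> k [/FF0].
  pose M : S := exist _ [set g | F g /\ forall g', F g' -> g' x <= g x]
    (conj fM MF0).
  have : le (exist _ F (conj fF FF0)) M by apply/asboolP => k [].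
  by move=> /Fmax/asboolP/(_ h' Fh')[_]; apply.
exists g; split; first exact: FK.
- by have [] := FF0 _ Fg.
- by move=> g1 g2 t K1 K2 gm; have [] := Ff _ _ _ _ Fg K1 K2 gm => /single.
Qed.
End ExtremePoints.

(** * Orthogonal projection onto a closed subspace *)

Section Projection.
Context {R : realType} {H : hilbertType R}.
Variable V : set H.
Hypotheses (clV : closed V) (V0 : V 0).
Hypothesis Vlin : forall (k : R[i]) x y, V x -> V y -> V (k *: x + y).

Local Notation g := (@hform R H).

Lemma hformxx (x : H) : g x x = rnorm x ^+ 2. Proof. exact: rdotxx. Qed.

Lemma VZ k x : V x -> V (k *: x).
Proof. by move=> Vx; have := Vlin k Vx V0; rewrite addr0. Qed.

Lemma VD x y : V x -> V y -> V (x + y).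
Proof. by move=> Vx Vy; have := Vlin 1 Vx Vy; rewrite scale1r. Qed.

(** If b <> 0, the value at t = b / (c^2 + 1) is negative. *)
Lemma quad_ge0_eq0 (b c : R) : (forall t, 0 <= t ^+ 2 * c - 2 * t * b) -> b = 0.
Proof.
move=> h; apply/eqP; apply: contraT => b0.
have c1 : 0 < c ^+ 2 + 1 by have := sqr_ge0 c; lra.
have b2 : 0 < b ^+ 2 by rewrite exprn_even_gt0.
have := h (b / (c ^+ 2 + 1)).
have -> : (b / (c ^+ 2 + 1)) ^+ 2 * c - 2 * (b / (c ^+ 2 + 1)) * b
   = b ^+ 2 * (c - 2 * (c ^+ 2 + 1)) / (c ^+ 2 + 1) ^+ 2.
  by field; rewrite gt_eqF.
rewrite pmulr_lge0 ?invr_gt0 ?exprn_gt0 // pmulr_rge0 //.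
by nra.
Qed.

(** A minimizing sequence for the distance from x to V is Cauchy by the
    parallelogram law, and its limit y minimizes; so x - y is orthogonal to V by
    [quad_ge0_eq0]. *)
Lemma projection_exists x : exists y, V y /\ forall v, V v -> g (x - y) v = 0.
Proof.
pose D := [set rnorm (x - v) ^+ 2 | v in V].
have D0 : D !=set0 by exists (rnorm (x - 0) ^+ 2), 0.
have Dlb : has_lbound D by exists 0 => _ [v _ <-]; rewrite sqr_ge0.
pose d := inf D.
have dle v : V v -> d <= rnorm (x - v) ^+ 2 by move=> Vv; apply: ge_inf => //; exists v.
have ex n : exists v, V v /\ rnorm (x - v) ^+ 2 < d + n.+1%:R^-1.
  have [|_ [v Vv <-] h] := @inf_adherent _ D (n.+1%:R^-1) _ (conj D0 Dlb).
    by rewrite invr_gt0 ltr0n.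
  by exists v.
pose u n := sval (cid (ex n)).
have uV n : V (u n) by have [] := svalP (cid (ex n)).
have ud n : rnorm (x - u n) ^+ 2 < d + n.+1%:R^-1.
  by have [] := svalP (cid (ex n)).
have half : 2^-1 + 2^-1 = 1 :> R by field.
have par m n : rnorm (u m - u n) ^+ 2 <= 2 * (m.+1%:R^-1 + n.+1%:R^-1).
  have Vm : V ((2^-1)%:C%C *: (u m + u n)) by apply: VZ; exact: VD.
  have := dle _ Vm; have := ud m; have := ud n.
  rewrite -!hformxx !rfBl !rfBr !rfZl !rfZr !rfDl !rfDr !(rfC g x).
  rewrite (rfC g (u n) (u m)).
  set a := m.+1%:R^-1; set b := n.+1%:R^-1; lra.
have small e : 0 < e -> exists N, forall n, (N <= n)%N -> n.+1%:R^-1 < e :> R.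
  have [|h _] := @nullP R harmonic; first by move=> ?; rewrite invr_ge0.
  exact: h (@cvg_harmonic R) e.
have /rcauchy_tends[y uy] : rcauchy u.
  move=> e e0; have [|N hN] := small (e ^+ 2 / 4).
    by rewrite divr_gt0 // exprn_gt0.
  exists N => m n Nm Nn.
  rewrite -(@ltr_pXn2r _ 2) ?nnegrE ?rnorm_ge0 ?(ltW e0) //.
  apply: le_lt_trans (par m n) _.
  have := hN _ Nm; have := hN _ Nn.
  by set a := m.+1%:R^-1; set b := n.+1%:R^-1; lra.
have Vy : V y := closed_tends clV uV uy.
have dy : rnorm (x - y) ^+ 2 <= d.
  have hx : tends (fun n => x - u n) (x - y).
    have := tendsD (tends_cst x) (tendsZ (-1) uy); rewrite scaleN1r.
    by apply: tends_eq => n; rewrite scaleN1r.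
  have := rlim_le (rlim_sqr (tends_norm hx)) (rlimD (cvg_cst d) (@cvg_harmonic R)).
  by rewrite addr0; apply => n; rewrite ltW.
exists y; split => // v Vv; apply: (@quad_ge0_eq0 _ (g v v)) => t.
have Vt : V (t%:C%C *: v + y) by exact: Vlin.
have := le_trans dy (dle _ Vt).
rewrite opprD addrA (addrAC x) -!hformxx.
move: (x - y) => z.
by rewrite !rfBl !rfBr !rfZl !rfZr (rfC g v z); lra.
Qed.

Definition oproj x : H := sval (cid (projection_exists x)).

Lemma oproj_in x : V (oproj x).
Proof. by have [] := svalP (cid (projection_exists x)). Qed.

Lemma oproj_orth x v : V v -> g (x - oproj x) v = 0.
Proof. by have [_] := svalP (cid (projection_exists x)); apply. Qed.

Lemma oproj_unique x y : V y -> (forall v, V v -> g (x - y) v = 0) -> oproj x = y.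
Proof.
move=> Vy h; apply/eqP; rewrite -subr_eq0; apply/eqP/rnorm0_eq0.
have Vd : V (oproj x - y).
  by rewrite -scaleN1r addrC; apply: Vlin => //; exact: oproj_in.
have := h _ Vd; have := oproj_orth x Vd.
have -> : x - y = (x - oproj x) + (oproj x - y) by rewrite addrA subrK.
rewrite (rfDl g (x - oproj x)) => -> /eqP.
by rewrite add0r hformxx sqrf_eq0 => /eqP.
Qed.

Lemma oproj_linear : linear oproj.
Proof.
move=> k x y; apply: oproj_unique; first by apply: Vlin; exact: oproj_in.
move=> v Vv; rewrite opprD addrACA -scalerBr (rfDl g (k *: _)).
rewrite [g (y - _) v]oproj_orth // addr0.
by rewrite scaleC rfDl !rfZl rfIl !oproj_orth ?oppr0 ?mulr0 ?addr0 //; exact: VZ.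
Qed.

Lemma oproj_id x : V x -> oproj x = x.
Proof. by move=> Vx; apply: oproj_unique => // v _; rewrite subrr rf0l. Qed.

Lemma oproj_sym x y : g (oproj x) y = g (oproj x) (oproj y).
Proof.
have := oproj_orth y (oproj_in x); rewrite rfC rfBr => /eqP.
by rewrite subr_eq0 => /eqP.
Qed.

Lemma oproj_commute (f f' : H -> H) : linear f ->
  (forall v, V v -> V (f v)) -> (forall v, V v -> V (f' v)) ->
  (forall x y, g (f x) y = g x (f' y)) ->
  forall x, oproj (f x) = f (oproj x).
Proof.
move=> fl fV f'V fa x; apply: oproj_unique; first by apply/fV/oproj_in.
move=> v Vv.
have -> : f x - f (oproj x) = f (x - oproj x).
  by have := fl (-1) (oproj x) x; rewrite !scaleN1r ![- _ + _]addrC.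
by rewrite fa oproj_orth //; exact: f'V.
Qed.
End Projection.

(** * States on the columns over a C*-algebra *)

Section States.
Context {R : realType} {A : cstarType R} {n : nat}.
Local Notation V := {ffun 'I_n -> A}.

Definition mulcol (a : A) (v : V) : V := [ffun j => cmul a (v j)].
Definition unitcol (j : 'I_n) : V := [ffun i => if i == j then cone else 0].

(** Such a G is the real part of (v, w) |-> <sum_j v_j x_j, sum_j w_j x_j> for
    vectors x_1, ..., x_n of a representation, with |x_1|^2 + ... + |x_n|^2 = 1.
    Equivalently it encodes a state on the n x n matrices over A; in this form its
    GNS space carries a representation of A itself. *)
Definition matrix_state (G : V * V -> R) : Prop :=
  [/\ forall v w, G (v, w) = G (w, v),
      forall v v' w, G (v + v', w) = G (v, w) + G (v', w),
      forall t v w, G (t%:C%C *: v, w) = t * G (v, w),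
      forall v w, G ('i%C *: v, 'i%C *: w) = G (v, w) &
      forall v, 0 <= G (v, v)] /\
  (forall a v w, G (mulcol a v, w) = G (v, mulcol (star a) w)) /\
  \sum_j G (unitcol j, unitcol j) = 1.

Definition state_form G (h : matrix_state G) : rform V :=
  let: conj (And5 h1 h2 h3 h4 h5) _ := h in
  @RForm R V (fun v w => G (v, w)) h1 h2 h3 h4 h5.

Lemma state_formE G (h : matrix_state G) v w : state_form h v w = G (v, w).
Proof. by case: h => [[h1 h2 h3 h4 h5] h]. Qed.

Lemma mulcol_linearl v : linear (mulcol ^~ v).
Proof. by move=> k a b; apply/ffunP => j; rewrite !ffunE cmulDl cmulZl. Qed.

Lemma mulcol_linearr a : linear (mulcol a).
Proof. by move=> k v w; apply/ffunP => j; rewrite !ffunE cmulDr cmulZr. Qed.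

Lemma mulcolM a b v : mulcol (cmul a b) v = mulcol a (mulcol b v).
Proof. by apply/ffunP => j; rewrite !ffunE cmulA. Qed.

Lemma mulcol1 v : mulcol cone v = v.
Proof. by apply/ffunP => j; rewrite !ffunE cmul1a. Qed.

Lemma col_decomp (v : V) : v = \sum_j mulcol (v j) (unitcol j).
Proof.
apply/ffunP => i; rewrite sum_ffunE (bigD1 i) //= !ffunE eqxx cmula1.
rewrite big1 ?addr0 // => j ji; rewrite !ffunE eq_sym (negbTE ji).
exact: cmul0.
Qed.

Lemma state_module G (h : matrix_state G) :
  star_module (state_form h) mulcol.
Proof.
split; [exact: mulcol_linearl|exact: mulcol_linearr|exact: mulcolM|].
by move=> a v w; rewrite !state_formE; case: h => _ [].
Qed.

Lemma state_norm_le G (h : matrix_state G) (v : V) :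
  form_seminorm (state_form h) v <= \sum_j rnorm (v j).
Proof.
rewrite {1}(col_decomp v); apply: le_trans (sn_sum _ _) _.
apply: ler_sum => j _; apply: le_trans (act_contractive (state_module h) _ _) _.
rewrite ler_piMr ?rnorm_ge0 // -(@ler_pXn2r _ 2) ?nnegrE ?sn_ge0 //.
rewrite form_seminorm_sqr state_formE expr1n.
have [_ [_ <-]] := h; rewrite (bigD1 j) //= lerDl sumr_ge0 // => i _.
by rewrite -(state_formE h) rf_ge0.
Qed.

Lemma state_bound G (h : matrix_state G) v w :
  `|G (v, w)| <= (\sum_j rnorm (v j)) * (\sum_j rnorm (w j)).
Proof.
rewrite -(state_formE h); apply: le_trans (rf_abs_le _ _ _) _.
by apply: ler_pM; rewrite ?sqrtr_ge0 //; exact: state_norm_le.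
Qed.

Local Notation P := (@ptw R (V * V)%type).

Lemma closed_eq_fun (f g : P -> R) : continuous f -> continuous g ->
  closed [set G | f G = g G].
Proof.
move=> fc gc.
have -> : [set G | f G = g G] = (fun G => f G - g G) @^-1` [set x | x = 0].
  apply/seteqP; split => G /= h; first by rewrite h subrr.
  by apply/eqP; rewrite -subr_eq0 h.
apply: closed_comp; last exact: closed_eq.
by move=> G _; exact: (cvgB (fc G) (gc G)).
Qed.

Lemma closed_forall (I : Type) (B : I -> set P) :
  (forall i, closed (B i)) -> closed [set G | forall i, B i G].
Proof.
move=> h; have -> : [set G | forall i, B i G] = \bigcap_(i in setT) B i.
  by apply/seteqP; split => G /= hG i; [move=> _; exact: hG|exact: hG].
by apply: closed_bigI => i _.
Qed.

Lemma add_fun_continuous (f g : P -> R) : continuous f -> continuous g ->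
  continuous (fun G => f G + g G).
Proof. by move=> fc gc G; exact: (cvgD (fc G) (gc G)). Qed.

Lemma scale_fun_continuous (c : R) (f : P -> R) : continuous f ->
  continuous (fun G => c * f G).
Proof. by move=> fc G; exact: (cvgM (cvg_cst c) (fc G)). Qed.

Lemma evalc (x : V * V) : continuous (fun G : P => G x).
Proof. exact: eval_continuous. Qed.

Lemma sum_continuous (I : finType) (f : I -> P -> R) :
  (forall i, continuous (f i)) -> continuous (fun G => \sum_i f i G).
Proof.
move=> fc; apply: continuous_big => [|i _]; last exact: fc.
exact: add_continuous.
Qed.

Lemma closed_states : closed (matrix_state : set P).
Proof.
have -> : (matrix_state : set P) =
    [set G : P | forall v w, G (v, w) = G (w, v)] `&`
    ([set G : P | forall v v' w, G (v + v', w) = G (v, w) + G (v', w)] `&`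
    ([set G : P | forall t v w, G (t%:C%C *: v, w) = t * G (v, w)] `&`
    ([set G : P | forall v w, G ('i%C *: v, 'i%C *: w) = G (v, w)] `&`
    ([set G : P | forall v, 0 <= G (v, v)] `&`
    ([set G : P | forall a v w, G (mulcol a v, w) = G (v, mulcol (star a) w)] `&`
    [set G : P | \sum_j G (unitcol j, unitcol j) = 1]))))).
  apply/seteqP; split => G /=; first by move=> [[? ? ? ? ?] []].
  by move=> [? [? [? [? [? []]]]]].
apply: closedI.
  apply: closed_forall => v; apply: closed_forall => w.
  by apply: closed_eq_fun; exact: evalc.
apply: closedI.
  apply: closed_forall => v; apply: closed_forall => v'; apply: closed_forall => w.
  by apply: closed_eq_fun; [|apply: add_fun_continuous]; exact: evalc.
apply: closedI.
  apply: closed_forall => t; apply: closed_forall => v; apply: closed_forall => w.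
  by apply: closed_eq_fun; [|apply: scale_fun_continuous]; exact: evalc.
apply: closedI.
  apply: closed_forall => v; apply: closed_forall => w.
  by apply: closed_eq_fun; exact: evalc.
apply: closedI.
  by apply: closed_forall => v; apply: closed_ge_fun; exact: evalc.
apply: closedI.
  apply: closed_forall => a; apply: closed_forall => v; apply: closed_forall => w.
  by apply: closed_eq_fun; exact: evalc.
apply: closed_eq_fun; first by apply: sum_continuous => j; exact: evalc.
exact: (@cst_continuous P R 1).
Qed.

(** States are uniformly bounded at each pair of columns, so they form a closed
    subset of a product of segments. *)
Lemma compact_states : compact (matrix_state : set P).
Proof.
pose b (v : V) := \sum_j rnorm (v j).
pose B (x : V * V) : set R := `[- (b x.1 * b x.2), b x.1 * b x.2]%classic.
have cB : compact [set G : P | forall x, B x (G x)].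
  by apply: (@tychonoff _ (fun=> R) B) => x; exact: segment_compact.
apply: (subclosed_compact closed_states cB) => G h [v w].
have := state_bound h v w; rewrite /B /= ler_norml => hh.
by rewrite in_itv.
Qed.

(** The squared norm of T (x_1, ..., x_n), for the vectors x_j that define G. *)
Definition state_value (T : 'M[A]_n) (G : P) : R :=
  \sum_i G ([ffun j => T i j], [ffun j => T i j]).

Lemma state_value_continuous T : continuous (state_value T).
Proof. by apply: sum_continuous => i; exact: evalc. Qed.

Lemma state_value_affine T : affine (state_value T).
Proof.
move=> g g1 g2 t [_ h]; rewrite /state_value !mulr_sumr -big_split /=.
by apply: eq_bigr => i _; rewrite h.
Qed.
End States.

(** * Extreme states have irreducible GNS representations *)

(* Otherwise simplification unfolds [hform] to the complex form, and the lemmas on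
   real forms no longer apply. *)
#[local] Arguments rf : simpl never.

Section HilbertLimits.
Context {R : realType} {H : hilbertType R}.
Local Notation g := (@hform R H).

Lemma hform_CS (x y : H) : `|g x y| <= rnorm x * rnorm y.
Proof. by rewrite -!hform_norm; exact: rf_abs_le. Qed.

Lemma tends_form (u : nat -> H) x y :
  tends u x -> (fun n => g (u n) y) @ \oo --> g x y.
Proof.
move=> ux; apply/subr_cvg0/norm_cvg0P.
have h0 := rlimZ (c := rnorm y) ux; rewrite mulr0 in h0.
apply: null_le h0 => n /=; rewrite normr_ge0 -rfBl mulrC.
exact: hform_CS.
Qed.

Lemma orth_dense (y : H) (u : nat -> H) :
  tends u y -> (forall n, g y (u n) = 0) -> y = 0.
Proof.
move=> uy h; apply/rnorm0_eq0/eqP; rewrite -sqrf_eq0; apply/eqP.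
have h0 := rlimZ (c := rnorm y) uy; rewrite mulr0 in h0.
apply/eqP; rewrite eq_le sqr_ge0 andbT.
apply: (rlim_le (cvg_cst (rnorm y ^+ 2)) h0) => n.
apply: le_trans (hform_CS y (u n - y)); rewrite rfBr h sub0r normrN.
by rewrite hformxx ler_norm.
Qed.
End HilbertLimits.

Section InducedStates.
Context {R : realType} {A : cstarType R} {n : nat} {H : hilbertType R}.
Local Notation V := {ffun 'I_n -> A}.
Local Notation g := (@hform R H).
Variables (s : A -> H -> H) (F : V -> H).
Hypotheses (sP : star_rep s) (Flin : linear F).
Hypothesis Fs : forall a v, F (mulcol a v) = s a (F v).

Definition weight : R := \sum_j rnorm (F (unitcol j)) ^+ 2.

(** An A-linear map F from the columns to a representation is given by the vectors
    F (unitcol j), and normalizing these gives a state. *)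
Lemma induced_state : 0 < weight ->
  matrix_state (fun x : V * V => weight^-1 * g (F x.1) (F x.2)).
Proof.
move=> w0.
split; first split => /=.
- by move=> v w; rewrite rfC.
- by move=> v v' w; rewrite (linD Flin) rfDl mulrDr.
- by move=> t v w; rewrite (linZ Flin) rfZl mulrCA.
- by move=> v w; rewrite !(linZ Flin) rfI.
- by move=> v; rewrite mulr_ge0 ?invr_ge0 ?(ltW w0) // rf_ge0.
split => /=.
  move=> a v w; rewrite !Fs; have [_ _ _ hs] := star_rep_module sP.
  by rewrite hs.
rewrite -mulr_sumr; under eq_bigr do rewrite hformxx.
by rewrite mulVf // gt_eqF.
Qed.
End InducedStates.

Section ExtremeStates.
Context {R : realType} {A : cstarType R} {n : nat}.
Local Notation V := {ffun 'I_n -> A}.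
Variables (G : V * V -> R) (h : matrix_state G).
Hypothesis Gext : forall G1 G2 t, matrix_state G1 -> matrix_state G2 ->
  mix G G1 G2 t -> G1 = G.

Local Notation K := (hcompletion (state_form h)).
Let e : V -> K := emb (form_seminorm (state_form h)).
Variable s : A -> K -> K.
Hypothesis sP : star_rep s.
Hypothesis se : forall a v, s a (e v) = e (mulcol a v).

Local Notation g := (@hform R K).

Lemma hform_e v w : g (e v) (e w) = G (v, w).
Proof. by rewrite -(state_formE h) -(cform_emb (state_form h)). Qed.

Let elin : linear e. Proof. exact: embP. Qed.

Lemma e_orth (y : K) : (forall v, g y (e v) = 0) -> y = 0.
Proof.
have [u uy] := completion_dense (y : completion _).
by move=> hy; apply: (@orth_dense _ _ y (e \o u)) => // k; exact: hy.
Qed.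

Lemma commute_zero (D : K -> K) : linear D ->
  (forall a x, D (s a x) = s a (D x)) ->
  (forall j, D (e (unitcol j)) = 0) -> forall v, D (e v) = 0.
Proof.
move=> Dlin Ds D0 v.
have sum0 : D (e v) = \sum_j D (e (mulcol (v j) (unitcol j))).
  by rewrite {1}(col_decomp v) (lin_sum elin) (lin_sum Dlin).
rewrite sum0 big1 // => j _; rewrite -se Ds D0.
by have [/(_ (v j))[sl _] _ _ _] := sP; exact: (lin0 sl).
Qed.

(** Let P be the projection onto a closed invariant subspace, and Q = 1 - P; both
    commute with the representation. With t the total squared norm of the vectors
    P (e (unitcol j)), the state G is t times the state induced by P plus 1 - t
    times the one induced by Q, unless t is 0 or 1, in which case P or Q
    vanishes. By extremality <P x, y> = t <x, y>, that is P = t; then P^2 = P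
    forces P = 0. *)
Lemma extreme_irreducible : irreducible_rep s.
Proof.
have [_ [hinv hs1]] := h.
have actM := star_rep_module sP.
split => //.
  have [j j0] : exists j, G (unitcol j, unitcol j) != 0.
    apply/existsP; apply: contraT; rewrite negb_exists => /forallP j0.
    by have /eqP := hs1; rewrite big1 ?(eq_sym 0) ?oner_eq0 // => j _;
      apply/eqP; have := j0 j; rewrite negbK.
  exists cone, (e (unitcol j)); rewrite se mulcol1.
  by apply: contra_neq j0 => ej; rewrite -hform_e ej rf0l.
move=> W clW W0 Wlin Ws.
pose P := oproj clW W0 Wlin.
have Plin : linear P by exact: oproj_linear.
have slin a : linear (s a) by have [/(_ a)[]] := sP.
have adj a y z : g (s a y) z = g y (s (star a) z).
  by have [_ _ _ ->] := actM.
have Ps a x : P (s a x) = s a (P x).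
  exact: (oproj_commute clW W0 Wlin (slin a) (Ws a) (Ws (star a)) (adj a)).
pose Q x := x - P x.
have Qlin : linear Q.
  by move=> k x y; rewrite /Q Plin opprD addrACA -scalerBr.
have Qs a x : Q (s a x) = s a (Q x).
  by rewrite /Q Ps (linB (slin a)).
have PQ x y : g (P x) (Q y) = 0 by rewrite rfC oproj_orth //; exact: oproj_in.
have split_g x y : g x y = g (P x) (P y) + g (Q x) (Q y).
  have xE : x = P x + Q x by rewrite /Q addrC subrK.
  have yE : y = P y + Q y by rewrite /Q addrC subrK.
  rewrite {1}xE {1}yE; move: (PQ x y) (PQ y x).
  move: (P x) (Q x) (P y) (Q y) => a b c d h1 h2.
  by rewrite rfDl !rfDr h1 (rfC g b) h2 addr0 add0r.
have Gsplit v w : G (v, w) = g (P (e v)) (P (e w)) + g (Q (e v)) (Q (e w)).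
  by rewrite -hform_e split_g.
pose t := weight (P \o e); pose t' := weight (Q \o e).
have tt' : t + t' = 1.
  rewrite -hs1 /t /t' /weight -big_split /=; apply: eq_bigr => j _.
  by rewrite Gsplit !hformxx.
have w0 (D : K -> K) : 0 <= weight (D \o e).
  by apply: sumr_ge0 => j _; exact: sqr_ge0.
have w_eq0 (D : K -> K) : weight (D \o e) = 0 -> forall j, D (e (unitcol j)) = 0.
  move=> /eqP; rewrite psumr_eq0; last by move=> j _; exact: sqr_ge0.
  move=> /allP Dj j; have := Dj j (mem_index_enum j).
  by rewrite /= sqrf_eq0 => /eqP/rnorm0_eq0.
have Pe0 : (forall v, P (e v) = 0) -> W = [set 0].
  move=> P0; apply/seteqP; split => [y Wy|_ ->] //=; apply: e_orth => v.
  have Qy : Q y = 0 by rewrite /Q /P oproj_id ?subrr.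
  by rewrite split_g P0 Qy rf0r rf0l addr0.
have Qe0 : (forall v, Q (e v) = 0) -> W = setT.
  move=> Q0; apply/seteqP; split => // x _.
  suff Qx : Q x = 0.
    by have -> : x = P x; [apply/eqP; rewrite -subr_eq0; apply/eqP|exact: oproj_in].
  apply: e_orth => v.
  have -> : e v = P (e v) by apply/eqP; rewrite -subr_eq0; apply/eqP; exact: Q0.
  by rewrite rfC PQ.
have [t0|t0] := eqVneq t 0.
  by left; apply/Pe0/commute_zero => //; exact: w_eq0.
have [t1|t1] := eqVneq t' 0.
  by right; apply/Qe0/commute_zero => //; exact: w_eq0.
have tp : 0 < t by rewrite lt_def t0 w0.
have tp' : 0 < t' by rewrite lt_def t1 w0.
have comp_lin (D : K -> K) : linear D -> linear (D \o e).
  by move=> Dlin k x y /=; rewrite elin Dlin.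
have comp_s (D : K -> K) : (forall a x, D (s a x) = s a (D x)) ->
    forall a v, (D \o e) (mulcol a v) = s a ((D \o e) v).
  by move=> Ds a v /=; rewrite -se Ds.
have G1 := induced_state sP (comp_lin _ Plin) (comp_s _ Ps) tp.
have G2 := induced_state sP (comp_lin _ Qlin) (comp_s _ Qs) tp'.
have /(Gext G1 G2) GE : mix G
    (fun x : V * V => t^-1 * g ((P \o e) x.1) ((P \o e) x.2))
    (fun x : V * V => t'^-1 * g ((Q \o e) x.1) ((Q \o e) x.2)) t.
  split; first by rewrite tp /=; lra.
  move=> [v w] /=; rewrite (_ : 1 - t = t'); last by lra.
  by rewrite !mulVKf ?gt_eqF // Gsplit.
have PE v : P (e v) = t%:C%C *: e v.
  apply/eqP; rewrite -subr_eq0; apply/eqP/e_orth => w.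
  have /= Gvw := congr1 (fun f => f (v, w)) GE.
  rewrite rfBl rfZl hform_e -Gvw mulVKf ?gt_eqF //.
  by rewrite [X in X - _](oproj_sym clW W0 Wlin) subrr.
left; apply: Pe0 => v.
have PP : P (P (e v)) = P (e v) by apply: oproj_id; exact: oproj_in.
have : (1 - t)%:C%C *: P (e v) = 0.
  by rewrite rmorphB rmorph1 scalerBl scale1r -(linZ Plin) -PE PP subrr.
move=> /eqP; rewrite scaler_eq0 => /orP[|/eqP //].
rewrite (_ : 1 - t = t'); last by lra.
by move=> /eqP/complexI/eqP; rewrite gt_eqF.
Qed.
End ExtremeStates.

(** * Irreducible representations compute matrix norms *)

Section IrreducibleNorm.
Context {R : realType} {A : cstarType R} {n : nat}.
Local Notation V := {ffun 'I_n -> A}.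

Definition mxcol (T : 'M[A]_n) (i : 'I_n) : V := [ffun j => T i j].

Lemma op_mxnorm_ge (H : hilbertType R) (S : 'M[H -> H]_n) (x : 'I_n -> H) :
  \sum_j rnorm (x j) ^+ 2 <= 1 ->
  ((Num.sqrt (\sum_i rnorm (\sum_j S i j (x j)) ^+ 2))%:E <= op_mxnorm S)%E.
Proof. by move=> x1; apply: ereal_sup_ubound; exists x. Qed.

(** Vectors x_j of total squared norm at most 1 at which T exceeds c induce, after
    normalization, a state with [state_value T] larger than c^2. Some extreme state maximizes this affine
    function, and its GNS representation is irreducible. *)
Lemma irreducible_norming (T : 'M[A]_n) (H : hilbertType R) (s : A -> H -> H)
    (c : R) : star_rep s -> 0 <= c -> (c%:E < op_mxnorm (map_mx s T))%E ->
  exists (K : hilbertType R) (t : A -> K -> K),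
    irreducible_rep t /\ (c%:E < op_mxnorm (map_mx t T))%E.
Proof.
move=> sP c0 /ereal_sup_gt[_ [x /= x1 <-]]; rewrite lte_fin => cx.
have [sb sl sM _] := sP.
have slin a : linear (s a) by have [] := sb a.
have s0 y : s 0 y = 0 by rewrite (lin0 sl).
pose F (v : V) : H := \sum_j s (v j) (x j).
have Flin : linear F.
  move=> k v w; rewrite /F scaler_sumr -big_split /=; apply: eq_bigr => j _.
  by rewrite !ffunE sl.
have Fs a v : F (mulcol a v) = s a (F v).
  rewrite /F (lin_sum (slin a)); apply: eq_bigr => j _.
  by rewrite ffunE sM.
have Fu j : F (unitcol j) = s cone (x j).
  rewrite /F (bigD1 j) //= ffunE eqxx big1 ?addr0 // => i ij.
  by rewrite ffunE (negbTE ij) s0.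
(* s(1) is a contraction, so the vectors s(1) x_j that define the induced state have
   total squared norm at most 1. *)
have one_le1 : rnorm (cone : A) <= 1.
  have := cstar_rnorm (cone : A); rewrite cmula1 star_one.
  by have := rnorm_ge0 (cone : A); nra.
have w1 : weight F <= 1.
  apply: le_trans x1; apply: ler_sum => j _.
  rewrite ler_pXn2r ?nnegrE ?rnorm_ge0 // Fu.
  apply: le_trans (star_rep_contractive sP _ _) _.
  by rewrite ler_piMl ?rnorm_ge0.
have FT i : \sum_j (map_mx s T) i j (x j) = F (mxcol T i).
  by apply: eq_bigr => j _; rewrite mxE ffunE.
pose N := \sum_i rnorm (F (mxcol T i)) ^+ 2.
have cN : c ^+ 2 < N.
  have N0 : 0 <= N by apply: sumr_ge0 => i _; rewrite sqr_ge0.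
  rewrite -(sqr_sqrtr N0) ltr_pXn2r ?nnegrE ?sqrtr_ge0 //.
  by move: cx; under eq_bigr do rewrite FT.
have w0 : 0 < weight F.
  rewrite lt_def sumr_ge0 ?andbT; last by move=> j _; exact: sqr_ge0.
  apply: contraTneq cN => /eqP.
  rewrite psumr_eq0; last by move=> j _; exact: sqr_ge0.
  move=> /allP Fj; have {}Fj j : F (unitcol j) = 0.
    have := Fj j (mem_index_enum j).
    by rewrite /= sqrf_eq0 => /eqP/rnorm0_eq0.
  rewrite -leNgt /N big1 ?sqr_ge0 // => i _.
  rewrite (col_decomp (mxcol T i)) (lin_sum Flin) big1 ?rnorm0 ?expr0n // => j _.
  by rewrite Fs Fj (lin0 (slin _)).
have hG0 := induced_state sP Flin Fs w0.
set G0 := (X in matrix_state X) in hG0.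
have [G [hG Gmax Gext]] := extreme_max (@compact_states R A n) (@closed_states R A n)
  (ex_intro _ G0 hG0) (@state_value_continuous R A n T) (@state_value_affine R A n T).
have cG : c ^+ 2 < state_value T G.
  apply: lt_le_trans cN (le_trans _ (Gmax _ hG0)).
  rewrite /state_value /G0 /= -mulr_sumr.
  rewrite -[X in X <= _]mul1r; under [X in _ <= _ * X]eq_bigr do rewrite hformxx.
  apply: ler_pM => //; first by apply: sumr_ge0 => i _; rewrite sqr_ge0.
  by rewrite invf_ge1.
have [t [tP te]] := gns (state_module hG).
exists _, t; split; first exact: (extreme_irreducible Gext tP te).
pose e (v : V) : hcompletion (state_form hG) := emb (form_seminorm (state_form hG)) v.
have en v : rnorm (e v) ^+ 2 = G (v, v).
  by rewrite -hformxx hform_e.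
have eT i : \sum_j (map_mx t T) i j (e (unitcol j)) = e (mxcol T i).
  rewrite [in RHS](col_decomp (mxcol T i)).
  rewrite (lin_sum (embP (form_seminorm (state_form hG)) : linear e)).
  by apply: eq_bigr => j _; rewrite mxE te ffunE.
have := @op_mxnorm_ge _ (map_mx t T) (fun j => e (unitcol j)).
under eq_bigr do rewrite en.
have [_ [_ ->]] := hG; move=> /(_ (lexx _)); apply: lt_le_trans.
under eq_bigr do rewrite eT en.
rewrite lte_fin -[X in X < _](ger0_norm c0) -sqrtr_sqr ltr_sqrt //.
exact: le_lt_trans (sqr_ge0 c) cG.
Qed.
End IrreducibleNorm.

(** * Completion of a C*-algebra in a C*-seminorm *)

Record cstar_seminorm (R : realType) (A : cstarType R) := CStarSeminorm {
  csn :> seminorm A ;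
  csnM : forall a b : A, csn (cmul a b) <= csn a * csn b ;
  csnE : forall a : A, csn (cmul (star a) a) = csn a ^+ 2 }.

Section CStarCompletion.
Context {R : realType} {A : cstarType R} (p : cstar_seminorm A).

Lemma csn_starE a : p (star a) = p a.
Proof.
have h b : p b <= p (star b).
  have := csnM p (star b) b; rewrite csnE.
  have [->|b0] := eqVneq (p b) 0; first by rewrite sn_ge0.
  have b1 : 0 < p b by rewrite lt_def b0 sn_ge0.
  by rewrite expr2 ler_pM2r.
by apply/eqP; rewrite eq_le h andbT; have := h (star a); rewrite starK.
Qed.

Definition ccompletion := completion p.
HB.instance Definition _ := CompleteNormedModule.on ccompletion.

Definition cemb : A -> ccompletion := emb p.

Lemma cemb_linear : linear cemb. Proof. exact: embP. Qed.

Lemma rnorm_cemb a : rnorm (cemb a) = p a. Proof. exact: rnorm_emb. Qed.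

Lemma cemb_dense (x : ccompletion) : exists u, tends (cemb \o u) x.
Proof. exact: completion_dense. Qed.

Fact cmul_ext : exists M : ccompletion -> ccompletion -> ccompletion,
  forall u x v y, tends (cemb \o u) x -> tends (cemb \o v) y ->
    tends (cemb \o (fun n => cmul (u n) (v n))) (M x y).
Proof.
apply: (@extension2 R A A p p ccompletion (fun a b => cemb (cmul a b))).
- by move=> v w w'; rewrite cmulBr (linB cemb_linear).
- by move=> v v' w; rewrite cmulBl (linB cemb_linear).
- by move=> v w; rewrite rnorm_cemb csnM.
Qed.

Fact star_ext : exists F : ccompletion -> ccompletion, forall u x,
  tends (cemb \o u) x -> tends (cemb \o (star \o u)) (F x).
Proof.
apply: (@extension R A p ccompletion (cemb \o star) 1) => v w /=.
by rewrite -(linB cemb_linear) -starB rnorm_cemb csn_starE mul1r.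
Qed.

Definition ccmul := sval (cid cmul_ext).
Definition ccstar := sval (cid star_ext).

Lemma ccmul_tends u x v y : tends (cemb \o u) x -> tends (cemb \o v) y ->
  tends (cemb \o (fun n => cmul (u n) (v n))) (ccmul x y).
Proof. exact: (svalP (cid cmul_ext)). Qed.

Lemma ccstar_tends u x : tends (cemb \o u) x ->
  tends (cemb \o (star \o u)) (ccstar x).
Proof. exact: (svalP (cid star_ext)). Qed.

Lemma cemb_cst a : tends (cemb \o (fun=> a)) (cemb a).
Proof. exact: (tends_cst (cemb a)). Qed.

Lemma cemb_add u v x y : tends (cemb \o u) x -> tends (cemb \o v) y ->
  tends (cemb \o (fun n => u n + v n)) (x + y).
Proof.
by move=> ux vy; apply: tends_eq (tendsD ux vy) => n /=; rewrite (linD cemb_linear).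
Qed.

Lemma cemb_scale k u x : tends (cemb \o u) x ->
  tends (cemb \o (fun n => k *: u n)) (k *: x).
Proof.
by move=> ux; apply: tends_eq (tendsZ k ux) => n /=; rewrite (linZ cemb_linear).
Qed.

Lemma tends_same (u v : nat -> A) (x y : ccompletion) :
  tends (cemb \o u) x -> tends (cemb \o v) y -> u =1 v -> x = y.
Proof. by move=> ux vy /funext uv; apply: (tends_unique ux); rewrite uv. Qed.

Fact ccmulA : associative ccmul.
Proof.
move=> x y z; have [u ux] := cemb_dense x; have [v vy] := cemb_dense y.
have [w wz] := cemb_dense z.
apply: (tends_same (ccmul_tends ux (ccmul_tends vy wz))
  (ccmul_tends (ccmul_tends ux vy) wz)) => n; exact: cmulA.
Qed.

Fact ccmul1a : left_id (cemb cone) ccmul.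
Proof.
move=> x; have [u ux] := cemb_dense x.
by apply: (tends_same (ccmul_tends (cemb_cst _) ux) ux) => n; rewrite cmul1a.
Qed.

Fact ccmula1 : right_id (cemb cone) ccmul.
Proof.
move=> x; have [u ux] := cemb_dense x.
by apply: (tends_same (ccmul_tends ux (cemb_cst _)) ux) => n; rewrite cmula1.
Qed.

Fact ccmul_linearl (z : ccompletion) : linear (ccmul ^~ z).
Proof.
move=> k x y; have [u ux] := cemb_dense x; have [v vy] := cemb_dense y.
have [w wz] := cemb_dense z.
apply: (tends_same (ccmul_tends (cemb_add (cemb_scale k ux) vy) wz)
  (cemb_add (cemb_scale k (ccmul_tends ux wz)) (ccmul_tends vy wz))) => n.
by rewrite cmulDl cmulZl.
Qed.

Fact ccmul_linearr (z : ccompletion) : linear (ccmul z).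
Proof.
move=> k x y; have [u ux] := cemb_dense x; have [v vy] := cemb_dense y.
have [w wz] := cemb_dense z.
apply: (tends_same (ccmul_tends wz (cemb_add (cemb_scale k ux) vy))
  (cemb_add (cemb_scale k (ccmul_tends wz ux)) (ccmul_tends wz vy))) => n.
by rewrite cmulDr cmulZr.
Qed.

Fact ccstarD : {morph ccstar : x y / x + y}.
Proof.
move=> x y; have [u ux] := cemb_dense x; have [v vy] := cemb_dense y.
apply: (tends_same (ccstar_tends (cemb_add ux vy))
  (cemb_add (ccstar_tends ux) (ccstar_tends vy))) => n /=.
exact: starD.
Qed.

Fact ccstarZ (k : R[i]) (x : ccompletion) : ccstar (k *: x) = k^* *: ccstar x.
Proof.
have [u ux] := cemb_dense x.
apply: (tends_same (ccstar_tends (cemb_scale k ux))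
  (cemb_scale (k^*) (ccstar_tends ux))) => n /=.
exact: starZ.
Qed.

Fact ccstarM x y : ccstar (ccmul x y) = ccmul (ccstar y) (ccstar x).
Proof.
have [u ux] := cemb_dense x; have [v vy] := cemb_dense y.
apply: (tends_same (ccstar_tends (ccmul_tends ux vy))
  (ccmul_tends (ccstar_tends vy) (ccstar_tends ux))) => n /=.
exact: starM.
Qed.

Fact ccstarK : involutive ccstar.
Proof.
move=> x; have [u ux] := cemb_dense x.
apply: (tends_same (ccstar_tends (ccstar_tends ux)) ux) => n /=.
exact: starK.
Qed.

Fact ccmul_norm x y : `|ccmul x y| <= `|x| * `|y|.
Proof.
rewrite !rnormE -rmorphM lecR.
have [u ux] := cemb_dense x; have [v vy] := cemb_dense y.
apply: (rlim_le (tends_sn (ccmul_tends ux vy)) (rlimM (tends_sn ux) (tends_sn vy))).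
by move=> n; exact: csnM.
Qed.

Fact cc_cstar_norm x : `|ccmul (ccstar x) x| = `|x| ^+ 2.
Proof.
rewrite !rnormE -rmorphXn; congr (_%:C)%C.
have [u ux] := cemb_dense x.
apply: (rlim_uniq (tends_sn (ccmul_tends (ccstar_tends ux) ux))).
by apply: rlim_eq (rlim_sqr (tends_sn ux)) => n; rewrite csnE.
Qed.

HB.instance Definition _ := CompleteNormedModule_isCStar.Build R ccompletion
  ccmulA ccmul1a ccmula1 ccmul_linearl ccmul_linearr ccstarD ccstarZ ccstarM
  ccstarK ccmul_norm cc_cstar_norm.

Lemma cembM a b : cemb (cmul a b) = cmul (cemb a) (cemb b).
Proof.
exact: (tends_same (cemb_cst _) (ccmul_tends (cemb_cst a) (cemb_cst b))).
Qed.

Lemma cemb_star a : cemb (star a) = star (cemb a).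
Proof. exact: (tends_same (cemb_cst _) (ccstar_tends (cemb_cst a))). Qed.

Section RepExtension.
Context {K : hilbertType R} (s : A -> K -> K).
Hypotheses (sP : star_rep s) (sp : forall a x, rnorm (s a x) <= p a * rnorm x).

(** For fixed x the map a |-> s a x is Lipschitz for p, with constant the norm of x,
    so [extension] applies. *)
Lemma rep_extension : exists t : ccompletion -> K -> K, star_rep t /\
  forall a, t (cemb a) = s a.
Proof.
have [sb sl sM sS] := sP.
have slin a : linear (s a) by have [] := sb a.
have ex x : exists F : ccompletion -> K, forall u b,
    tends (cemb \o u) b -> tends (s ^~ x \o u) (F b).
  apply: (@extension R A p K (s ^~ x) (rnorm x)) => a b.
  by rewrite mulrC (_ : s a x - s b x = s (a - b) x) ?sp // (linB sl).
pose t b x := sval (cid (ex x)) b.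
have tP u b x : tends (cemb \o u) b -> tends (fun n => s (u n) x) (t b x).
  exact: (svalP (cid (ex x))).
have tE a x : t (cemb a) x = s a x.
  exact: (tends_unique (tP _ _ x (cemb_cst a)) (tends_cst _)).
have tn b x : rnorm (t b x) <= rnorm b * rnorm x.
  have [u ub] := cemb_dense b.
  have h := rlimZ (c := rnorm x) (tends_sn ub).
  rewrite mulrC; apply: (rlim_le (tends_norm (tP _ _ x ub)) h) => n.
  by rewrite mulrC.
have tlin b : linear (t b).
  move=> k x y; have [u ub] := cemb_dense b.
  apply: (tends_unique (tP _ _ _ ub)).
  by apply: tends_eq (tendsD (tendsZ k (tP _ _ x ub)) (tP _ _ y ub)) => n;
    rewrite slin.
have tl : linear t.
  move=> k b c; apply/funext => x.
  have [u ub] := cemb_dense b; have [v vc] := cemb_dense c.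
  apply: (tends_unique (tP _ _ _ (cemb_add (cemb_scale k ub) vc))).
  by apply: tends_eq (tendsD (tendsZ k (tP _ _ x ub)) (tP _ _ x vc)) => n;
    rewrite sl.
exists t; split; last by move=> a; apply/funext => x; exact: tE.
split => //.
- move=> b; split => //; exists (rnorm b)%:C%C => x.
  by rewrite !rnormE -rmorphM lecR; exact: tn.
- move=> b c; apply/funext => x.
  have [u ub] := cemb_dense b; have [v vc] := cemb_dense c.
  apply: (tends_unique (tP _ _ _ (ccmul_tends ub vc))) => /=.
  apply: (tends_near (tP _ _ (t c x) ub)).
  have h := rlimM (tends_sn ub) (tP _ _ x vc); rewrite mulr0 in h.
  apply: null_le h => n; rewrite rnorm_ge0 /= sM /=.
  by rewrite -(linB (slin _)) sp.
- move=> b x y.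
  have h z w : hform (t b z) w = hform z (t (star b) w).
    have [u ub] := cemb_dense b.
    have [_ _ _ hs] := star_rep_module sP.
    have h1 := tP _ _ z ub; have h2 := tP _ _ w (ccstar_tends ub).
    apply: (rlim_uniq (tends_form (y := w) h1)).
    rewrite [hform z _]rfC.
    apply: rlim_eq (tends_form (y := z) h2) => n.
    by rewrite rfC hs.
  rewrite !hdot_cplx /cplx_form !h.
  by rewrite (linZ (tlin _)).
Qed.
End RepExtension.
End CStarCompletion.

(** * Suprema of operator seminorms, and matrices over a C*-algebra *)

Lemma rf_le (R : realType) (V : lmodType R[i]) (g : rform V) x y :
  g x y <= form_seminorm g x * form_seminorm g y.
Proof. exact: le_trans (ler_norm _) (rf_abs_le _ _ _). Qed.

(** The supremum of the operator seminorms of a family of actions of M. It is used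
    for the action of an algebra on Hilbert spaces and for that of the matrices
    over the algebra on columns of vectors. The index type I may be large, as it
    will consist of representations. *)
Section SupSeminorm.
Context {R : realType} {M : lmodType R[i]} {I : Type}.
Variables (W : I -> lmodType R[i]) (g : forall i, rform (W i)).
Variables (act : forall i, M -> W i -> W i) (b : M -> R).
Local Notation "`[ v ]_ i" := (form_seminorm (g i) v) (at level 0).
Hypothesis actl : forall i v, linear ((@act i)^~ v).
Hypothesis actr : forall i S, linear (@act i S).
Hypothesis actb : forall i S v, `[@act i S v]_i <= b S * `[v]_i.

Definition act_values (S : M) : set R :=
  [set r | r = 0 \/ exists i v, `[v]_i <= 1 /\ r = `[@act i S v]_i].

Definition act_sup (S : M) : R := sup (act_values S).

Lemma act_values_sup S : has_sup (act_values S).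
Proof.
split; first by exists 0; left.
exists `|b S| => _ [->|[i [v [v1 ->]]]]; first exact: normr_ge0.
apply: le_trans (@actb _ _ _) _.
apply: le_trans (ler_wpM2r (sn_ge0 _ _) (ler_norm (b S))) _.
by rewrite ler_piMr.
Qed.

Lemma act_sup_ge0 S : 0 <= act_sup S.
Proof. by apply: sup_upper_bound; [exact: act_values_sup|left]. Qed.

Lemma act_sup_ub i S v : `[@act i S v]_i <= act_sup S * `[v]_i.
Proof.
have [v0|v0] := eqVneq (`[v]_i) 0.
  by apply: le_trans (@actb _ _ _) _; rewrite v0 !mulr0.
have vp : 0 < `[v]_i by rewrite lt_def v0 sn_ge0.
pose w := (`[v]_i^-1)%:C%C *: v.
have -> : @act i S v = (`[v]_i)%:C%C *: @act i S w.
  by rewrite (linZ (@actr i S)) scalerA -rmorphM mulfV // scale1r.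
rewrite snZ rabsR (gtr0_norm vp) mulrC ler_pM2r //.
apply: sup_upper_bound; first exact: act_values_sup.
right; exists i, w; split => //.
by rewrite snZ rabsR gtr0_norm ?invr_gt0 // mulVf.
Qed.

Lemma act_sup_le S c : 0 <= c -> (forall i v, `[@act i S v]_i <= c * `[v]_i) ->
  act_sup S <= c.
Proof.
move=> c0 h; apply: ge_sup; first by have [] := act_values_sup S.
move=> _ [->//|[i [v [v1 ->]]]]; apply: le_trans (h _ _) _.
by rewrite ler_piMr.
Qed.

Lemma act_supD S T : act_sup (S + T) <= act_sup S + act_sup T.
Proof.
apply: act_sup_le => [|i v]; first by rewrite addr_ge0 ?act_sup_ge0.
rewrite (linD (@actl i v)) mulrDl; apply: le_trans (snD _ _ _) _.
by rewrite lerD ?act_sup_ub.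
Qed.

Lemma act_supZ k S : act_sup (k *: S) = rabs k * act_sup S.
Proof.
have h l T : act_sup (l *: T) <= rabs l * act_sup T.
  apply: act_sup_le => [|i v]; first by rewrite mulr_ge0 ?rabs_ge0 ?act_sup_ge0.
  by rewrite (linZ (@actl i v)) snZ -mulrA ler_wpM2l ?rabs_ge0 ?act_sup_ub.
apply/eqP; rewrite eq_le h /=.
have [->|k0] := eqVneq k 0; first by rewrite rabsR normr0 mul0r act_sup_ge0.
have := h k^-1 (k *: S); rewrite scalerA mulVf // scale1r.
have k1 : rabs k * rabs k^-1 = 1 by rewrite -rabsM mulfV // /rabs normr1.
move=> h1; have := ler_wpM2l (rabs_ge0 k) h1.
by rewrite mulrA k1 mul1r.
Qed.

Definition act_seminorm : seminorm M := Seminorm act_supD act_supZ.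

Section Algebra.
Variables (mul : M -> M -> M) (adj : M -> M).
Hypothesis actM : forall i S T v, @act i (mul S T) v = @act i S (@act i T v).
Hypothesis actA : forall i S v w, g i (@act i S v) w = g i v (@act i (adj S) w).

Lemma act_supM S T : act_sup (mul S T) <= act_sup S * act_sup T.
Proof.
apply: act_sup_le => [|i v]; first by rewrite mulr_ge0 ?act_sup_ge0.
rewrite (@actM i) -mulrA; apply: le_trans (@act_sup_ub _ _ _) _.
by rewrite ler_wpM2l ?act_sup_ge0 ?act_sup_ub.
Qed.

Lemma act_sup_adj S : act_sup (adj S) <= act_sup S.
Proof.
apply: act_sup_le => [|i v]; first exact: act_sup_ge0.
set w := @act i (adj S) v.
have h : `[w]_i ^+ 2 <= act_sup S * `[w]_i * `[v]_i.
  rewrite form_seminorm_sqr /w -(@actA i) -/w.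
  apply: le_trans (rf_le _ _ _) _.
  by rewrite ler_wpM2r ?sn_ge0 ?act_sup_ub.
have [->|w0] := eqVneq (`[w]_i) 0; first by rewrite mulr_ge0 ?act_sup_ge0 ?sn_ge0.
have wp : 0 < `[w]_i by rewrite lt_def w0 sn_ge0.
by move: h; rewrite expr2 mulrAC ler_pM2r.
Qed.

Lemma act_supE S : act_sup (mul (adj S) S) = act_sup S ^+ 2.
Proof.
apply/eqP; rewrite eq_le; apply/andP; split.
  apply: le_trans (@act_supM _ _) _.
  by rewrite expr2 ler_wpM2r ?act_sup_ge0 ?act_sup_adj.
rewrite -[leRHS]sqr_sqrtr ?act_sup_ge0 //.
rewrite ler_pXn2r ?nnegrE ?act_sup_ge0 ?sqrtr_ge0 //.
apply: act_sup_le => [|i v]; first exact: sqrtr_ge0.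
rewrite -(@ler_pXn2r _ 2) ?nnegrE ?mulr_ge0 ?sqrtr_ge0 ?sn_ge0 //.
rewrite exprMn [Num.sqrt (act_sup _) ^+ 2]sqr_sqrtr ?act_sup_ge0 //.
rewrite form_seminorm_sqr (@actA i) -(@actM i) mulrC expr2 -mulrA.
apply: le_trans (rf_le _ _ _) _.
by rewrite ler_wpM2l ?sn_ge0 // mulrC act_sup_ub.
Qed.
End Algebra.
End SupSeminorm.

Section ColumnForm.
Context {R : realType} {n : nat} {H : hilbertType R}.
Local Notation Hn := {ffun 'I_n -> H}.
Implicit Types v w : Hn.

Definition col_dot v w : R := \sum_j hform (v j) (w j).

Fact col_dotC v w : col_dot v w = col_dot w v.
Proof. by apply: eq_bigr => j _; rewrite rfC. Qed.
Fact col_dotD v v' w : col_dot (v + v') w = col_dot v w + col_dot v' w.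
Proof. by rewrite -big_split; apply: eq_bigr => j _; rewrite ffunE rfDl. Qed.
Fact col_dotZ (t : R) v w : col_dot (t%:C%C *: v) w = t * col_dot v w.
Proof. by rewrite mulr_sumr; apply: eq_bigr => j _; rewrite ffunE rfZl. Qed.
Fact col_dotI v w : col_dot ('i%C *: v) ('i%C *: w) = col_dot v w.
Proof. by apply: eq_bigr => j _; rewrite !ffunE rfI. Qed.
Fact col_dot_ge0 v : 0 <= col_dot v v.
Proof. by apply: sumr_ge0 => j _; exact: rf_ge0. Qed.

Definition col_form : rform Hn :=
  RForm col_dotC col_dotD col_dotZ col_dotI col_dot_ge0.

Lemma col_form_sqr v : form_seminorm col_form v ^+ 2 = \sum_j rnorm (v j) ^+ 2.
Proof. by rewrite form_seminorm_sqr; apply: eq_bigr => j _; rewrite hformxx. Qed.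

Lemma col_form_norm v :
  form_seminorm col_form v = Num.sqrt (\sum_j rnorm (v j) ^+ 2).
Proof. by rewrite -col_form_sqr sqrtr_sqr ger0_norm ?sn_ge0. Qed.

Lemma entry_le v j : rnorm (v j) <= form_seminorm col_form v.
Proof.
rewrite -(@ler_pXn2r _ 2) ?nnegrE ?rnorm_ge0 ?sn_ge0 // col_form_sqr.
by rewrite (bigD1 j) //= lerDl sumr_ge0 // => i _; exact: sqr_ge0.
Qed.

Definition single j (x : H) : Hn := [ffun i => if i == j then x else 0].

Lemma single_norm j x : form_seminorm col_form (single j x) = rnorm x.
Proof.
rewrite col_form_norm (bigD1 j) //= ffunE eqxx big1 ?addr0.
  by rewrite sqrtr_sqr ger0_norm ?rnorm_ge0.
by move=> i ij; rewrite ffunE (negbTE ij) rnorm0 expr0n.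
Qed.

Lemma single_decomp v : v = \sum_j single j (v j).
Proof.
apply/ffunP => i; rewrite sum_ffunE (bigD1 i) //= !ffunE eqxx.
by rewrite big1 ?addr0 // => j ji; rewrite !ffunE eq_sym (negbTE ji).
Qed.
End ColumnForm.

Section MatrixAlgebra.
Context {R : realType} {A : cstarType R} {n : nat}.
Local Notation M := {ffun 'I_n * 'I_n -> A}.
Implicit Types S T U : M.

(** Matrices are finite functions here, because these form a module over R[i] for
    every module of coefficients. *)
Definition mmul S T : M := [ffun ij => \sum_k cmul (S (ij.1, k)) (T (k, ij.2))].
Definition mstar S : M := [ffun ij => star (S (ij.2, ij.1))].

Lemma mmulBl S T U : mmul (S - T) U = mmul S U - mmul T U.
Proof.
apply/ffunP => ij; rewrite !ffunE -sumrB; apply: eq_bigr => k _.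
by rewrite !ffunE cmulBl.
Qed.

Lemma mmulBr S T U : mmul S (T - U) = mmul S T - mmul S U.
Proof.
apply/ffunP => ij; rewrite !ffunE -sumrB; apply: eq_bigr => k _.
by rewrite !ffunE cmulBr.
Qed.

Lemma star_sum (I : finType) (F : I -> A) : star (\sum_i F i) = \sum_i star (F i).
Proof.
apply: big_morph => [x y|]; [exact: starD|exact: star0].
Qed.

Lemma mstarM S T : mstar (mmul S T) = mmul (mstar T) (mstar S).
Proof.
apply/ffunP => ij; rewrite !ffunE star_sum; apply: eq_bigr => k _.
by rewrite !ffunE starM.
Qed.

Lemma mstarK : involutive mstar.
Proof. by move=> S; apply/ffunP => -[i j]; rewrite !ffunE starK. Qed.

Lemma mstarD S T : mstar (S + T) = mstar S + mstar T.
Proof. by apply/ffunP => ij; rewrite !ffunE starD. Qed.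

Lemma mstarZ (t : R) S : mstar (t%:C%C *: S) = t%:C%C *: mstar S.
Proof. by apply/ffunP => ij; rewrite !ffunE starZ conjR. Qed.

Section Ampliation.
Context {H : hilbertType R} (s : A -> H -> H) (sP : star_rep s).
Local Notation Hn := {ffun 'I_n -> H}.

Definition ampl S (v : Hn) : Hn := [ffun i => \sum_j s (S (i, j)) (v j)].

Let sl : linear s. Proof. by have [] := sP. Qed.
Let slin a : linear (s a). Proof. by have [/(_ a)[]] := sP. Qed.

Lemma ampl_linearl v : linear (ampl ^~ v).
Proof.
move=> k S T; apply/ffunP => i; rewrite !ffunE scaler_sumr -big_split.
by apply: eq_bigr => j _; rewrite !ffunE sl.
Qed.

Lemma ampl_linearr S : linear (ampl S).
Proof.
move=> k v w; apply/ffunP => i; rewrite !ffunE scaler_sumr -big_split.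
by apply: eq_bigr => j _; rewrite !ffunE slin.
Qed.

Lemma ampl_mul S T v : ampl (mmul S T) v = ampl S (ampl T v).
Proof.
have [_ _ sM _] := sP.
apply/ffunP => i; rewrite !ffunE.
transitivity (\sum_j \sum_k s (cmul (S (i, k)) (T (k, j))) (v j)).
  apply: eq_bigr => j _; rewrite ffunE (lin_sum sl).
  by rewrite (big_morph (fun f : H -> H => f (v j)) (id1 := 0) (op1 := +%R)).
rewrite exchange_big; apply: eq_bigr => k _.
rewrite ffunE (lin_sum (slin _)); apply: eq_bigr => j _.
by rewrite sM.
Qed.

Lemma ampl_adj S v w :
  col_form (ampl S v) w = col_form v (ampl (mstar S) w).
Proof.
have [_ _ _ adj] := star_rep_module sP.
rewrite /rf /= /col_dot.
transitivity (\sum_i \sum_j hform (s (S (i, j)) (v j)) (w i)).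
  by apply: eq_bigr => i _; rewrite ffunE rf_suml.
rewrite exchange_big; apply: eq_bigr => j _.
rewrite ffunE rf_sumr; apply: eq_bigr => i _.
by rewrite ffunE adj.
Qed.

Lemma ampl_bound S v : form_seminorm col_form (ampl S v) <=
  (\sum_ij rnorm (S ij)) * form_seminorm col_form v.
Proof.
rewrite [ampl S v]single_decomp; apply: le_trans (sn_sum _ _) _.
rewrite (eq_bigr (fun ij => rnorm (S (ij.1, ij.2)))); last by case.
rewrite -(pair_bigA _ (fun i j => rnorm (S (i, j)))) mulr_suml.
apply: ler_sum => i _; rewrite single_norm ffunE mulr_suml.
apply: (@le_trans _ _ (\sum_j rnorm (s (S (i, j)) (v j)))).
  exact: (sn_sum (Seminorm (@rnormD R H) (@rnormZ R H))).
apply: ler_sum => j _; apply: le_trans (star_rep_contractive sP _ _) _.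
by rewrite ler_wpM2l ?rnorm_ge0 // entry_le.
Qed.

Definition mxfun (T : 'M[A]_n) : M := [ffun ij => T ij.1 ij.2].

Lemma op_mxnorm_leP (T : 'M[A]_n) (c : R) : 0 <= c ->
  (op_mxnorm (map_mx s T) <= c%:E)%E <->
  (forall v, form_seminorm col_form (ampl (mxfun T) v) <=
     c * form_seminorm col_form v).
Proof.
move=> c0.
have E (x : 'I_n -> H) :
    Num.sqrt (\sum_i rnorm (\sum_j (map_mx s T) i j (x j)) ^+ 2) =
    form_seminorm col_form (ampl (mxfun T) [ffun j => x j]).
  rewrite col_form_norm; congr Num.sqrt; apply: eq_bigr => i _.
  rewrite ffunE; congr (rnorm _ ^+ 2); apply: eq_bigr => j _.
  by rewrite mxE !ffunE.
split => [h v|h].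
  have [v0|v0] := eqVneq (form_seminorm col_form v) 0.
    by apply: le_trans (ampl_bound _ _) _; rewrite v0 !mulr0.
  have vp : 0 < form_seminorm col_form v by rewrite lt_def v0 sn_ge0.
  set r := form_seminorm col_form v in v0 vp *.
  pose w : Hn := (r^-1)%:C%C *: v.
  have wE : [ffun j => w j] = w by apply/ffunP => j; rewrite ffunE.
  have w1 : form_seminorm col_form w = 1.
    by rewrite snZ rabsR gtr0_norm ?invr_gt0 // mulVf.
  have -> : v = r%:C%C *: w by rewrite scalerA -rmorphM mulfV // scale1r.
  rewrite (linZ (ampl_linearr _)) snZ rabsR (gtr0_norm vp) mulrC ler_pM2r //.
  rewrite -lee_fin; apply: le_trans h; rewrite -wE -E.
  by apply: op_mxnorm_ge; rewrite -col_form_sqr w1 expr1n.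
apply: ge_ereal_sup => _ [x /= x1 <-]; rewrite lee_fin E.
apply: le_trans (h _) _; rewrite ler_piMr //.
rewrite -(@ler_pXn2r _ 2) ?nnegrE ?sn_ge0 // expr1n col_form_sqr.
by under eq_bigr do rewrite ffunE.
Qed.
End Ampliation.
End MatrixAlgebra.

(** * The C*-seminorm of a family of representations *)

Section RepresentationFamilies.
Context {R : realType} {A : cstarType R}.
Variable S : forall K : hilbertType R, (A -> K -> K) -> Prop.
Hypothesis Srep : forall (K : hilbertType R) (s : A -> K -> K),
  S s -> star_rep s.

Record rep_in := RepIn {
  rep_space : hilbertType R ;
  rep_map : A -> rep_space -> rep_space ;
  rep_inP : S rep_map }.
Implicit Types i : rep_in.

Lemma rep_in_star i : star_rep (@rep_map i).
Proof. exact: Srep (rep_inP i). Qed.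

Lemma rep_in_linl i v : linear ((@rep_map i) ^~ v).
Proof. by have [h _ _ _] := star_rep_module (rep_in_star i); exact: h. Qed.

Lemma rep_in_linr i a : linear (@rep_map i a).
Proof. by have [_ h _ _] := star_rep_module (rep_in_star i); exact: h. Qed.

Lemma rep_in_mul i a b v : rep_map (cmul a b) v = @rep_map i a (rep_map b v).
Proof. by have [_ _ h _] := star_rep_module (rep_in_star i); exact: h. Qed.

Lemma rep_in_adj i a v w :
  hform (@rep_map i a v) w = hform v (@rep_map i (star a) w).
Proof. by have [_ _ _ h] := star_rep_module (rep_in_star i); exact: h. Qed.

Lemma rep_in_bound i a v : form_seminorm hform (@rep_map i a v) <=
  rnorm a * form_seminorm hform v.
Proof. by rewrite !hform_norm; exact: (star_rep_contractive (rep_in_star i)). Qed.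

Definition family_seminorm : seminorm A :=
  act_seminorm rep_in_linl rep_in_linr rep_in_bound.

Definition family_cstar : cstar_seminorm A :=
  @CStarSeminorm R A family_seminorm
    (act_supM rep_in_linr rep_in_bound rep_in_mul)
    (act_supE rep_in_linr rep_in_bound rep_in_mul rep_in_adj).

Lemma family_ub (K : hilbertType R) (s : A -> K -> K) a x : S s ->
  rnorm (s a x) <= family_cstar a * rnorm x.
Proof.
move=> Ss; have := act_sup_ub rep_in_linr rep_in_bound (i := RepIn Ss) a x.
by rewrite !hform_norm.
Qed.

Lemma family_le a c : 0 <= c ->
  (forall i x, rnorm (@rep_map i a x) <= c * rnorm x) -> family_cstar a <= c.
Proof.
move=> c0 h; apply: (act_sup_le rep_in_bound) => // i v.
by rewrite !hform_norm.
Qed.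

Lemma family_le_norm a : family_cstar a <= rnorm a.
Proof.
apply: family_le => [|i x]; first exact: rnorm_ge0.
exact: star_rep_contractive (rep_in_star i) a x.
Qed.

Section Matrices.
Context {n : nat}.
Local Notation M := {ffun 'I_n * 'I_n -> A}.
Let act i := @ampl R A n _ (@rep_map i).

Let al i v : linear ((@act i) ^~ v).
Proof. exact: ampl_linearl (rep_in_star i) v. Qed.
Let ar i T : linear (@act i T).
Proof. exact: ampl_linearr (rep_in_star i) T. Qed.
Let ab i T v : form_seminorm col_form (@act i T v) <=
  (\sum_ij rnorm (T ij)) * form_seminorm col_form v.
Proof. exact: ampl_bound (rep_in_star i) T v. Qed.

Definition family_mxseminorm : seminorm M := act_seminorm al ar ab.

Lemma family_mxM (T U : M) : family_mxseminorm (mmul T U) <=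
  family_mxseminorm T * family_mxseminorm U.
Proof.
by apply: (act_supM ar ab) => i X Y v; exact: ampl_mul (rep_in_star i) X Y v.
Qed.

Lemma family_mxE (T : M) : family_mxseminorm (mmul (mstar T) T) =
  family_mxseminorm T ^+ 2.
Proof.
apply: (act_supE ar ab) => [i X Y v|i X v w].
  exact: ampl_mul (rep_in_star i) X Y v.
exact: ampl_adj (rep_in_star i) X v w.
Qed.

Lemma family_mx_entry (T : M) ij : family_cstar (T ij) <= family_mxseminorm T.
Proof.
apply: family_le => [|i x]; first exact: sn_ge0.
have := act_sup_ub ar ab T (single ij.2 x) (i := i).
rewrite single_norm; apply: le_trans.
apply: le_trans (entry_le _ ij.1); rewrite ffunE (bigD1 ij.2) //= ffunE eqxx.
rewrite big1 ?addr0; first by case: ij.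
by move=> j jij; rewrite ffunE (negbTE jij) (lin0 (rep_in_linr _)).
Qed.

Lemma family_mx_le (T : 'M[A]_n) c : 0 <= c ->
  (forall i, (op_mxnorm (map_mx (@rep_map i) T) <= c%:E)%E) ->
  family_mxseminorm (mxfun T) <= c.
Proof.
move=> c0 h; apply: (act_sup_le ab) => // i v.
exact: ((op_mxnorm_leP (rep_in_star i) T c0).1 (h i) v).
Qed.

Local Notation B := (ccompletion family_cstar).
Local Notation e := (cemb family_cstar).

End Matrices.
End RepresentationFamilies.

(** * Representations of the completion are completely contractive *)

Section TendsSum.
Context {R : realType} {V : normedModType R[i]}.

Lemma tends_sum (I : Type) (r : seq I) (u : I -> nat -> V) (x : I -> V) :
  (forall k, tends (u k) (x k)) ->
  tends (fun m => \sum_(k <- r) u k m) (\sum_(k <- r) x k).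
Proof.
move=> ux; elim: r => [|k r IH].
  by rewrite big_nil; apply: tends_eq (tends_cst 0) => m; rewrite big_nil.
rewrite big_cons; apply: tends_eq (tendsD (ux k) IH) => m.
by rewrite big_cons.
Qed.
End TendsSum.

Section CompleteContraction.
Context {R : realType} {A : cstarType R}.
Variable S : forall K : hilbertType R, (A -> K -> K) -> Prop.
Hypothesis Srep : forall (K : hilbertType R) (s : A -> K -> K),
  S s -> star_rep s.
Context {n : nat}.
Local Notation p := (family_cstar Srep).
Local Notation PM := (family_mxseminorm Srep (n := n)).
Local Notation B := (ccompletion p).
Local Notation e := (cemb p).
Local Notation MA := {ffun 'I_n * 'I_n -> A}.
Local Notation MB := {ffun 'I_n * 'I_n -> B}.

Definition memb (T : MA) : MB := [ffun ij => e (T ij)].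

Lemma memb_mul (T U : MA) : memb (mmul T U) = mmul (memb T) (memb U).
Proof.
apply/ffunP => ij; rewrite !ffunE (lin_sum (cemb_linear p)).
by apply: eq_bigr => k _; rewrite !ffunE cembM.
Qed.

Lemma memb_star (T : MA) : memb (mstar T) = mstar (memb T).
Proof. by apply/ffunP => ij; rewrite !ffunE cemb_star. Qed.

Lemma memb_scale k (T : MA) : memb (k *: T) = k *: memb T.
Proof. by apply/ffunP => ij; rewrite !ffunE (linZ (cemb_linear p)). Qed.

(** The iteration [sqrt_iter] is run in the matrices over A, where it is Cauchy for
    the seminorm of the family. The limit exists entrywise in the completion. *)
Lemma matrix_quasi_sqrt (h : MA) : mstar h = h -> PM h < 1 ->
  exists D : MB, mstar D = D /\ memb h = 2%:C%C *: D - mmul D D.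
Proof.
move=> hs h1; pose d := sqrt_iter mmul h.
have cd : cauchy_in PM d.
  exact: (@sqrt_iter_cauchy _ _ PM mmul (@mmulBl R A n)
    (fun x y z => mmulBr x y z) (family_mxM Srep (n := n)) h (PM h)).
have ds k : mstar (d k) = d k.
  elim: k => [|k IH].
    by apply/ffunP => ij; rewrite !ffunE star0.
  by rewrite /d /= mstarZ mstarD mstarM -/(d k) IH hs.
have ex ij : exists y : B, tends (fun k => e (d k ij)) y.
  apply: (@rcauchy_tends R B) => r r0; have [N hN] := cd r r0.
  exists N => k l Nk Nl; apply: le_lt_trans (hN k l Nk Nl).
  rewrite -(linB (cemb_linear p)) rnorm_cemb.
  have := family_mx_entry Srep (d k - d l) ij.
  by rewrite !ffunE.
pose D : MB := [ffun ij => sval (cid (ex ij))].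
have dD ij : tends (fun k => e (d k ij)) (D ij).
  by rewrite ffunE; exact: svalP (cid (ex ij)).
exists D; split.
  apply/ffunP => ij; rewrite ffunE.
  apply: (tends_unique (tends_star (dD (ij.2, ij.1)))).
  apply: tends_eq (dD ij) => k /=.
  by rewrite -cemb_star -{1}(ds k) ffunE.
have DE ij : D ij = (2^-1)%:C%C *: (e (h ij) + mmul D D ij).
  have lim : tends (fun k => (2^-1)%:C%C *: (e (h ij) +
      \sum_l cmul (e (d k (ij.1, l))) (e (d k (l, ij.2)))))
      ((2^-1)%:C%C *: (e (h ij) + mmul D D ij)).
    apply/tendsZ/tendsD; first exact: tends_cst.
    rewrite ffunE; apply: tends_sum => l.
    exact: (tends_cmul (dD (ij.1, l)) (dD (l, ij.2))).
  apply: (tends_unique (tends_shift (dD ij))).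
  apply: tends_eq lim => k.
  rewrite /d /= -/(d k) !ffunE (linZ (cemb_linear p)) (linD (cemb_linear p)).
  rewrite (lin_sum (cemb_linear p)); congr (_ *: (_ + _)).
  by apply: eq_bigr => l _; rewrite cembM.
apply/ffunP => ij.
have -> : (2%:C%C *: D - mmul D D) ij = 2%:C%C *: D ij - mmul D D ij.
  by rewrite !ffunE.
rewrite {1}(DE ij) scalerA -rmorphM mulfV ?pnatr_eq0 // scale1r addrK.
by rewrite ffunE.
Qed.

(** As in [act_contractive], with matrices: for t > c, 1 - t^-2 T^*T is a square in
    the matrices over the completion, so every representation s of the completion
    maps it to a positive operator. *)
Lemma complete_contraction (K : hilbertType R) (s : B -> K -> K)
    (T : 'M[A]_n) (c : R) : star_rep s -> 0 <= c ->
  (forall i : rep_in S, (op_mxnorm (map_mx (@rep_map _ _ _ i) T) <= c%:E)%E) ->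
  (op_mxnorm (map_mx s (map_mx e T)) <= c%:E)%E.
Proof.
move=> sP c0 hc; apply/(op_mxnorm_leP sP _ c0) => v.
have -> : mxfun (map_mx e T) = memb (mxfun T).
  by apply/ffunP => ij; rewrite !ffunE mxE.
have Tc := family_mx_le Srep c0 hc.
set X := mxfun T in Tc *.
apply: le_mul_lim => [|t]; first exact: sn_ge0.
move=> ct; have t0 : 0 < t := le_lt_trans c0 ct.
pose h : MA := (t ^- 2)%:C%C *: mmul (mstar X) X.
have hs : mstar h = h by rewrite mstarZ mstarM mstarK.
have h1 : PM h < 1.
  rewrite snZ rabsR ger0_norm ?invr_ge0 ?sqr_ge0 // family_mxE.
  rewrite mulrC ltr_pdivrMr ?exprn_gt0 // mul1r.
  by rewrite ltr_pXn2r ?nnegrE ?sn_ge0 ?(ltW t0) //; apply: le_lt_trans ct.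
have [D [Ds Dh]] := matrix_quasi_sqrt hs h1.
rewrite -(@ler_pXn2r _ 2) ?nnegrE ?mulr_ge0 ?sn_ge0 ?(ltW t0) //.
rewrite exprMn !form_seminorm_sqr ampl_adj // -ampl_mul //.
have -> : mmul (mstar (memb X)) (memb X) = (t ^+ 2)%:C%C *: memb h.
  rewrite /h memb_scale scalerA -rmorphM mulfV ?expf_neq0 ?gt_eqF // scale1r.
  by rewrite memb_mul memb_star.
rewrite (linZ (ampl_linearl sP v)) rfZr ler_wpM2l ?sqr_ge0 // Dh.
rewrite (linB (ampl_linearl sP v)) (linZ (ampl_linearl sP v)) ampl_mul //.
rewrite rfBr rfZr; have := rf_ge0 col_form (v - ampl s D v).
rewrite !rfBl !rfBr.
have := ampl_adj sP D v (ampl s D v); rewrite Ds => <-.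
rewrite (rfC col_form (ampl s D v) v); lra.
Qed.
End CompleteContraction.

(** * Generation, and comparison of matrix norms *)

Section Generation.
Context {R : realType} {E : cstarType R}.

Lemma tends_rep (H : hilbertType R) (s : E -> H -> H) (u : nat -> E) a x :
  star_rep s -> tends u a -> tends (fun n => s (u n) x) (s a x).
Proof.
move=> sP ua; have [_ sl _ _] := sP.
have h := rlimZ (c := rnorm x) ua; rewrite mulr0 in h.
apply: null_le h => n; rewrite rnorm_ge0 /= mulrC.
have -> : s (u n) x - s a x = s (u n - a) x by rewrite (linB sl).
exact: star_rep_contractive.
Qed.

Lemma generated_ind (X Z : set E) : cstar_generated X = setT ->
  cstar_subalgebra Z -> X `<=` Z -> forall a, Z a.
Proof. by move=> genX Zsub XZ a; have : setT a by []; rewrite -genX; apply. Qed.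

Lemma star_rep_unique (H : hilbertType R) (s t : E -> H -> H) (X : set E) :
  star_rep s -> star_rep t -> cstar_generated X = setT ->
  (forall a, X a -> s a = t a) -> s = t.
Proof.
move=> sP tP genX st.
have [sb sl sM sS] := sP; have [tb tl tM tS] := tP.
have [_ _ _ sadj] := star_rep_module sP.
have [_ _ _ tadj] := star_rep_module tP.
apply/funext; apply: (generated_ind genX) st.
split.
- apply: closed_seq => u a ust ua; apply/funext => x.
  apply: (tends_unique (tends_rep x sP ua)).
  by apply: tends_eq (tends_rep x tP ua) => n; rewrite ust.
- by rewrite /= (lin0 sl) (lin0 tl).
- by move=> k a b /= ha hb; rewrite sl tl ha hb.
- by move=> a b /= ha hb; rewrite sM tM ha hb.
- move=> a /= ha; apply/funext => x; apply/eqP; rewrite -subr_eq0.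
  apply/eqP/rnorm0_eq0/eqP; rewrite -sqrf_eq0 -hformxx.
  by rewrite rfBl sadj tadj starK ha subrr.
Qed.

Lemma generated_dense (p : cstar_seminorm E) (X : set E) :
  (forall a, p a <= rnorm a) -> cstar_generated X = setT ->
  cstar_generated (cemb p @` X) = setT.
Proof.
move=> pn genX; apply/seteqP; split => // b _ Z [[clZ Z0 Zlin ZM Zstar] XZ].
have [u ub] := cemb_dense b; apply: (closed_tends clZ _ ub) => n /=.
move: (u n); apply: (generated_ind genX); last first.
  by move=> a Xa; apply: XZ; exists a.
split.
- apply: closed_seq => v a Zv va /=; apply: (closed_tends clZ Zv).
  by apply: null_le va => m; rewrite rnorm_ge0 -(linB (cemb_linear p)) rnorm_cemb pn.
- by rewrite /= (lin0 (cemb_linear p)).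
- by move=> k a c /= Za Zc; rewrite (cemb_linear p); exact: Zlin.
- by move=> a c /= Za Zc; rewrite cembM; exact: ZM.
- by move=> a /= Za; rewrite cemb_star; exact: Zstar.
Qed.
End Generation.

Section Norms.
Context {R : realType}.

Lemma op_mxnorm_ge0 (H : hilbertType R) n (T : 'M[H -> H]_n) :
  (0 <= op_mxnorm T)%E.
Proof.
apply: le_trans (@op_mxnorm_ge _ _ _ T (fun=> 0) _).
  by rewrite lee_fin sqrtr_ge0.
by rewrite big1 // => j _; rewrite rnorm0 expr0n.
Qed.

Lemma op_mxnorm_size0 (H : hilbertType R) (T : 'M[H -> H]_0) : op_mxnorm T = 0%E.
Proof.
apply/eqP; rewrite eq_le op_mxnorm_ge0 andbT.
by apply: ge_ereal_sup => _ [x _ <-]; rewrite big_ord0 sqrtr0.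
Qed.

Lemma isometry_rnorm (H K : hilbertType R) (U : H -> K) x :
  (forall x y, hdot (U x) (U y) = hdot x y) -> rnorm (U x) = rnorm x.
Proof.
move=> Uiso; apply/eqP; rewrite -(@eqrXn2 _ 2) ?rnorm_ge0 //.
by rewrite -!rdotxx /rdot Uiso.
Qed.

Lemma op_mxnorm_equiv (A : cstarType R) (H K : hilbertType R)
    (s : A -> H -> H) (t : A -> K -> K) n (T : 'M[A]_n) :
  unitarily_equivalent s t ->
  (op_mxnorm (map_mx s T) <= op_mxnorm (map_mx t T))%E.
Proof.
move=> [U [Ulin _ Uiso Us]]; apply: ge_ereal_sup => _ [x /= x1 <-].
have h := @op_mxnorm_ge _ _ _ (map_mx t T) (fun j => U (x j)).
apply: (le_trans _ (h _)); last first.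
  by under eq_bigr do rewrite (isometry_rnorm _ Uiso).
rewrite lee_fin ler_wsqrtr //.
apply: ler_sum => i _; rewrite -(isometry_rnorm _ Uiso) (lin_sum Ulin).
rewrite le_eqVlt; apply/orP; left; apply/eqP; congr (rnorm _ ^+ 2).
by apply: eq_bigr => j _; rewrite !mxE Us.
Qed.

Lemma zero_star_rep (A : cstarType R) (H : hilbertType R) :
  star_rep (fun (_ : A) (_ : H) => 0 : H).
Proof.
split.
- move=> a; split; first by move=> k x y; rewrite scaler0 addr0.
  by exists 0 => x; rewrite normr0 mul0r.
- by move=> k a b; apply/funext => x /=; rewrite -[RHS]/(k *: 0 + 0) scaler0 addr0.
- by [].
- move=> a x y; rewrite !hdot_cplx /cplx_form rf0l !rf0r.
  by rewrite scaler0 rf0l rf0r.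
Qed.

Lemma cstar_mxnorm_ub (A : cstarType R) (H : hilbertType R) (s : A -> H -> H)
    n (T : 'M[A]_n) : star_rep s -> (op_mxnorm (map_mx s T) <= cstar_mxnorm T)%E.
Proof. by move=> sP; apply: ereal_sup_ubound; exists H, s. Qed.

Lemma star_rep_comp (A B : cstarType R) (q : A -> B) (H : hilbertType R)
    (s : B -> H -> H) : star_hom q -> star_rep s -> star_rep (s \o q).
Proof.
move=> [ql qM qS] [sb sl sM sS]; split => /=.
- by move=> a; exact: sb.
- by move=> k a b; rewrite /= ql sl.
- by move=> a b; rewrite /= qM sM.
- by move=> a x y; rewrite /= qS sS.
Qed.

Lemma cemb_star_hom (A : cstarType R) (p : cstar_seminorm A) :
  star_hom (cemb p).
Proof.
split; [exact: cemb_linear|exact: cembM|exact: cemb_star].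
Qed.

Lemma map_mx_mx (X Y Z : Type) (f : X -> Y) (h : Y -> Z) n (T : 'M[X]_n) :
  map_mx h (map_mx f T) = map_mx (h \o f) T.
Proof. by apply/matrixP => i j; rewrite !mxE. Qed.
End Norms.

(** * Strongly peaking representations *)

Theorem lemma3p5 (R : realType) (H0 : hilbertType R) (A : set (H0 -> H0))
    (hA : unital_operator_algebra A)
    (E : cstarType R) (u : (H0 -> H0) -> E) (hE : cstar_envelope A u)
    (H : hilbertType R) (pi : E -> H -> H) (hpi : irreducible_rep pi) :
  strongly_peaking (u @` A) pi <-> strongly_peaking [set: E] pi.
Proof.
split; first by move=> [n [T [n0 _ h]]]; exists n, T.
move=> [n0 [T0 [_ _ peak]]].
have [piP [a0 [x0 pi0]] _] := hpi.
pose S (K : hilbertType R) (s : E -> K -> K) :=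
  irreducible_rep s /\ ~ unitarily_equivalent s pi.
have Srep (K : hilbertType R) (s : E -> K -> K) : S K s -> star_rep s.
  by move=> [[]].
pose p := family_cstar Srep; pose e := cemb p; pose B := ccompletion p.
have [[ulin u1 uci] genE univ] := hE.
pose iota (f : H0 -> H0) : B := e (u f).
have genB : cstar_generated (iota @` A) = setT.
  have := generated_dense (family_le_norm Srep) genE.
  by rewrite image_comp.
have lift (K : hilbertType R) (s : E -> K -> K) : S K s ->
    exists t : B -> K -> K, star_rep t /\ t \o e = s.
  move=> Ss; have [t [tP te]] := rep_extension (Srep _ _ Ss)
    (fun a x => family_ub Srep a x Ss).
  by exists t; split => //; apply/funext => a /=; exact: te.
(* If the images of A in B and in E have the same matrix norms, then B maps onto E
   compatibly with these images, which contradicts peaking over E. *)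
have [iota_ci|iota_nci] := pselect (unital_ci_map A iota).
  have [q [qhom _ qu]] := univ B iota iota_ci genB.
  have piqP : star_rep (pi \o q) := star_rep_comp qhom piP.
  have piq : pi \o q \o e = pi.
    apply: (star_rep_unique (star_rep_comp (cemb_star_hom p) piqP) piP genE).
    by move=> _ [f Af <-] /=; rewrite qu.
  have bound n (T : 'M[E]_n) (c : R) : 0 <= c ->
      (forall i : rep_in S, (op_mxnorm (map_mx (@rep_map _ _ _ i) T) <= c%:E)%E) ->
      (op_mxnorm (map_mx pi T) <= c%:E)%E.
    move=> c0 h; rewrite -piq -map_mx_mx.
    exact: complete_contraction piqP c0 h.
(* For an empty S the supremum is -oo and bounds nothing; but then B = 0. *)
  have [[K [s Ss]]|noS] := pselect (exists (K : hilbertType R) (s : E -> K -> K), S K s).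
    exfalso; move: peak; set m := ereal_sup _ => peak.
    have m_ub i : (op_mxnorm (map_mx (@rep_map _ _ S i) T0) <= m)%E.
      apply: ereal_sup_ubound; exists (rep_space i), (@rep_map _ _ _ i).
      by have [? ?] := rep_inP i.
    have m0 : (0 <= m)%E := le_trans (op_mxnorm_ge0 _) (m_ub (RepIn Ss)).
    move: m m0 m_ub peak => [c|//|//] c0 m_ub; last by rewrite ltNge leey.
    by rewrite ltNge bound.
  exfalso; move/eqP: pi0; apply; rewrite -piq /=.
  have -> : e a0 = 0.
    apply/rnorm0_eq0/eqP; rewrite eq_le rnorm_ge0 andbT rnorm_cemb.
    by apply: family_le => // i x; case: noS; exists (rep_space i), (@rep_map _ _ _ i);
      exact: rep_inP.
  have [ql _ _] := qhom; have [_ pl _ _] := piP.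
  by rewrite (lin0 ql) (lin0 pl).
(* Otherwise some matrix over A has a smaller norm in B than in E. *)
have [n [T [AT Tne]]] : exists n (T : 'M[H0 -> H0]_n), (forall i j, A (T i j)) /\
    cstar_mxnorm (map_mx iota T) <> op_mxnorm T.
  apply: contrapT => none; apply: iota_nci; split.
  - by move=> k f g Af Ag; rewrite /iota ulin //; exact: cemb_linear.
  - by rewrite /iota u1.
  - move=> n T AT; apply: contrapT => ne; apply: none.
    by exists n, T.
pose UT := map_mx u T.
have iotaT : map_mx iota T = map_mx e UT by rewrite map_mx_mx.
set m := cstar_mxnorm (map_mx iota T) in Tne.
have mlt : (m < cstar_mxnorm UT)%E.
  rewrite lt_neqAle; apply/andP; split.
    by apply/eqP; rewrite -/UT (uci n T AT).
  apply: ge_ereal_sup => _ [K [s [sP ->]]]; rewrite iotaT map_mx_mx.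
  exact/cstar_mxnorm_ub/star_rep_comp/sP/cemb_star_hom.
have m0 : (0 <= m)%E.
  exact: le_trans (op_mxnorm_ge0 _) (cstar_mxnorm_ub _ (zero_star_rep B H)).
have Sle (K : hilbertType R) (s : E -> K -> K) : S K s ->
    (op_mxnorm (map_mx s UT) <= m)%E.
  move=> /lift[t [tP <-]]; rewrite -map_mx_mx -iotaT.
  exact: cstar_mxnorm_ub.
(* An irreducible representation t at which the norm exceeds m does not factor
   through B, so it is equivalent to pi. *)
have pi_gt : (m < op_mxnorm (map_mx pi UT))%E.
  have /ereal_sup_gt[_ [K [s [sP ->]]]] := mlt.
  move: (m) m0 Sle => [c|//|//] c0 Sle; last by rewrite ltNge leey.
  move=> /(irreducible_norming sP c0)[L [t [tirr tgt]]].
  have [tpi|ntpi] := pselect (unitarily_equivalent t pi).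
    exact: lt_le_trans tgt (op_mxnorm_equiv _ tpi).
  by move: tgt; rewrite ltNge Sle.
exists n, UT; split.
(* For n = 0 all norms vanish, so the strict inequality excludes it. *)
- case: n T AT UT iotaT m mlt m0 {Tne} Sle pi_gt => // T AT UT iotaT m mlt m0 Sle.
  by rewrite op_mxnorm_size0 ltNge m0.
- by move=> i j; rewrite mxE; exists (T i j).
- apply: le_lt_trans pi_gt; apply: ge_ereal_sup => _ [K [s [sirr ns ->]]].
  by apply: Sle.
Qed.
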